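(* Let $L$ be a separable complex Hilbert space with a conjugation, and let $\mathcal F$ be the fermionic Fock space over $L$ with number operator $N$. Let $1\le r\le 2$, let $C\in B_r^-(L)$, and put $s:=\frac{2(r-1)}{r}$. Then, on the finite-particle subspace $\mathcal F_0$, $$ \Delta^+(C)^*\Delta^+(C)\le \begin{cases} \|C\|_1^2\,\mathbb 1, & r=1,\\ \|C\|_r^2\,N^s+3\|C\|_2^2\,\mathbb 1, & 1<r\le 2. \end{cases} $$
   Context: Inner products are antilinear in the first and linear in the second argument. $L$ is a separable complex Hilbert space with a conjugation $f\mapsto\bar f$ (antilinear isometric involution). Fock representation of the CAR over $L$: $\mathcal F$ is a complex Hilbert space and $f\mapsto a(f)$, $f\mapsto a^\dagger(f)$ are linear maps from $L$ into the bounded operators on $\mathcal F$ with $\{a(f),a(g)\}=0=\{a^\dagger(f),a^\dagger(g)\}$, $\{a(f),a^\dagger(g)\}=(\bar f,g)\mathbb 1$ (anticommutators), $a(f)^*=a^\dagger(\bar f)$, together with a unit vector $\Omega\in\mathcal F$ (vacuum) such that $a(f)\Omega=0$ for all $f\in L$ and the vectors $a^\dagger(f_n)\cdots a^\dagger(f_1)\Omega$ ($n\ge 0$, $f_i\in L$) span a dense subspace of $\mathcal F$. The $n$-particle space $\mathcal F^{(n)}$ is the closed span of the vectors $a^\dagger(f_n)\cdots a^\dagger(f_1)\Omega$; $\mathcal F$ is the orthogonal sum of the $\mathcal F^{(n)}$, $n\ge0$. $\mathcal F_0$ is the linear span of $\bigcup_n\mathcal F^{(n)}$. The transpose of a bounded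 operator $C$ on $L$ is $C^T:=\bar C^*$, where $\bar C f:=\overline{C\bar f}$. $B_r(L)$, $1\le r<\infty$, is the $r$-th von Neumann-Schatten class on $L$ with norm $\|C\|_r=(\sum_j\mu_j^r)^{1/r}$, $\mu_j$ the singular values of $C$, and $B_r^-(L)$ is the set of $C\in B_r(L)$ with $C^T=-C$. For $C\in B_2^-(L)$, $\Delta^+(C):=\sum_j a^\dagger(Ce_j)a^\dagger(\bar e_j)$ on $\mathcal F_0$, where $\{e_j\}$ is a complete orthonormal system in $L$ (well-defined on $\mathcal F_0$; maps $\mathcal F^{(n)}$ into $\mathcal F^{(n+2)}$). The number operator is $N:=\sum_j a^\dagger(e_j)a(\bar e_j)$; $N\Phi=n\Phi$ and $N^s\Phi=n^s\Phi$ for $\Phi\in\mathcal F^{(n)}$. Operator inequalities $X\le Y$ are meant as $(\Phi,X\Phi)\le(\Phi,Y\Phi)$ for all $\Phi\in\mathcal F_0$, with $(\Phi,T^*T\Phi)=\|T\Phi\|^2$. *)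

(* Defs.v *)
From HB Require Import structures.
From mathcomp Require Import all_boot all_order all_algebra.
From mathcomp Require Import complex.
From mathcomp Require Import boolp classical_sets cardinality.
From mathcomp Require Import reals ereal topology normedtype esum exp.
From mathcomp.analysis.showcase Require Import summability.

Set Implicit Arguments.
Unset Strict Implicit.
Unset Printing Implicit Defensive.

Import Order.TTheory GRing.Theory Num.Theory.
Import numFieldNormedType.Exports.

Local Open Scope classical_set_scope.
Local Open Scope ring_scope.
Local Open Scope complex_scope.

(* The inner product is antilinear in the first argument (by [ip_conj]) and
   linear in the second.  The norm of the underlying normed module takes its
   values in the nonnegative reals of R[i]. *)
HB.mixin Record isInnerProduct (R : realType) H
    of CompleteNormedModule R[i] H := {
  ip : H -> H -> R[i] ;
  ip_linear : forall (x : H) (c : R[i]) (y z : H),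
    ip x (c *: y + z) = c * ip x y + ip x z ;
  ip_conj : forall x y : H, ip y x = (ip x y)^* ;
  ip_norm : forall x : H, ip x x = `|x| ^+ 2
}.

#[short(type="hilbertType")]
HB.structure Definition Hilbert (R : realType) :=
  {H of CompleteNormedModule R[i] H & isInnerProduct R H}.

Section Hilbert_space.
Variables (R : realType) (H : hilbertType R).
Implicit Types (T : H -> H) (D : set H).

Definition separable : Prop := exists2 S : set H, countable S & dense S.

Definition lspan (A : set H) : set H :=
  [set x | exists n (c : 'I_n -> R[i]) (v : 'I_n -> H),
     (forall k, A (v k)) /\ x = \sum_k c k *: v k].

Definition cspan (A : set H) : set H := closure (lspan A).

Definition orthonormal (I : choiceType) (e : I -> H) : Prop :=
  forall i j, ip (e i) (e j) = (i == j)%:R.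

Definition complete_orthonormal (I : choiceType) (e : I -> H) : Prop :=
  orthonormal e /\ cspan (range e) = setT.

Definition bounded_operator T : Prop :=
  (forall (c : R[i]) x y, T (c *: x + y) = c *: T x + T y) /\
  exists M : R, forall x, `|T x| <= M%:C * `|x|.

(* By the Riesz representation theorem, the defining set is a singleton when
   T is bounded. *)
Definition adjoint T (y : H) : H :=
  get [set z : H | forall x, ip (T x) y = ip x z].

Record conjugation (cj : H -> H) : Prop := Conjugation {
  cj_antilinear : forall (c : R[i]) x y, cj (c *: x + y) = c^* *: cj x + cj y ;
  cj_isometry : forall x, `|cj x| = `|x| ;
  cj_involutive : forall x, cj (cj x) = x
}.

Definition conj_operator (cj : H -> H) T (f : H) : H := cj (T (cj f)).

Definition transpose (cj : H -> H) T : H -> H := adjoint (conj_operator cj T).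

(* mu lists the singular values of T, i.e. the square roots of the eigenvalues
   of T^* T, with multiplicity and including 0 (if it occurs): one for each
   member of a complete orthonormal system of eigenvectors. *)
Definition singular_values T (J : choiceType) (mu : J -> R) : Prop :=
  (forall j, 0 <= mu j) /\
  exists2 x : J -> H, complete_orthonormal x &
    forall j, adjoint T (T (x j)) = (mu j ^+ 2)%:C *: x j.

(* An operator with an orthonormal basis of eigenvectors of T^* T and with
   \sum_j mu_j^r < oo is compact; conversely T^* T has such a basis for every
   compact T. *)
Definition schatten (r : R) T : Prop :=
  bounded_operator T /\
  exists (J : choiceType) (mu : J -> R),
    singular_values T mu /\
    (esum [set: J] (fun j => (mu j `^ r)%:E) < +oo)%E.

(* The sum does not depend on the enumeration of the singular values. *)
Definition schatten_norm (r : R) T : R :=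
  get [set v : R | exists (J : choiceType) (mu : J -> R),
    singular_values T mu /\
    v = fine (esum [set: J] (fun j => (mu j `^ r)%:E)) `^ r^-1].

Definition schatten_antisym (cj : H -> H) (r : R) T : Prop :=
  schatten r T /\ forall f, transpose cj T f = - T f.

(* The power T^s, on vectors that are finite sums of eigenvectors of T in its
   domain D, of an operator T with nonnegative eigenvalues. *)
Definition operator_power D T (s : R) (Phi : H) : H :=
  get [set Psi : H | exists n (lam : 'I_n -> R) (phi : 'I_n -> H),
    [/\ forall k, [/\ 0 <= lam k, D (phi k) & T (phi k) = (lam k)%:C *: phi k],
        Phi = \sum_k phi k &
        Psi = \sum_k (lam k `^ s)%:C *: phi k]].

End Hilbert_space.

Section Fock_space.
Variables (R : realType) (L F : hilbertType R) (cj : L -> L).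
(* [a] and [ad] are the annihilation and creation operators. *)
Variables (a ad : L -> F -> F) (Omega : F).

(* [creations [:: f_n; ...; f_1]] is a^+(f_n) ... a^+(f_1) Omega. *)
Definition creations (fs : seq L) : F := foldr ad Omega fs.

Record fock_representation : Prop := FockRepresentation {
  fock_a_bounded : forall f, bounded_operator (a f) ;
  fock_ad_bounded : forall f, bounded_operator (ad f) ;
  fock_a_linear : forall (c : R[i]) f g Phi,
    a (c *: f + g) Phi = c *: a f Phi + a g Phi ;
  fock_ad_linear : forall (c : R[i]) f g Phi,
    ad (c *: f + g) Phi = c *: ad f Phi + ad g Phi ;
  fock_aa : forall f g Phi, a f (a g Phi) + a g (a f Phi) = 0 ;
  fock_adad : forall f g Phi, ad f (ad g Phi) + ad g (ad f Phi) = 0 ;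
  fock_aad : forall f g Phi,
    a f (ad g Phi) + ad g (a f Phi) = ip (cj f) g *: Phi ;
  fock_adjoint : forall f, adjoint (a f) = ad (cj f) ;
  fock_vacuum_unit : `|Omega| = 1 ;
  fock_vacuum : forall f, a f Omega = 0 ;
  fock_cyclic : dense (lspan (range creations))
}.

Definition particle_space (n : nat) : set F :=
  cspan (creations @` [set fs : seq L | size fs = n]).

Definition finite_particle : set F :=
  lspan (\bigcup_n particle_space n).

(* [sum] is the limit of the net of finite partial sums in the norm of F, as
   the index set of a complete orthonormal system may be finite or infinite. *)
Definition DeltaPlus (I : choiceType) (e : I -> L) (C : L -> L) (Phi : F) : F :=
  sum (fun j => ad (C (e j)) (ad (cj (e j)) Phi)).

Definition number_operator (I : choiceType) (e : I -> L) (Phi : F) : F :=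
  sum (fun j => ad (e j) (a (cj (e j)) Phi)).

Definition number_power (I : choiceType) (e : I -> L) (s : R) : F -> F :=
  operator_power finite_particle (number_operator e) s.

End Fock_space.

(* Main.v *)
(* If [mu k] are the singular values of [C], with orthonormal eigenvectors [x k]
   of [C^* C], then [Delta^+(C)] is the sum of the [a^+(C x_k) a^+(cj x_k)].
   For [r = 1] the triangle inequality suffices, since [|a^+(f)| <= |f|].
   For [r > 1], moving the annihilation operators to the right gives
     [Delta^+(C)^* Delta^+(C) <= Delta^+(C) Delta^+(C)^* + 2 |C|_2^2],
   because the quadratic terms subtracted form the entrywise product of two
   Gram matrices.  On the [n]-particle space [|Delta^+(C)^* Phi|] is at most
   the sum of the [mu k * z k], where [z k = |a^+(cj x_k)^* Phi|] satisfies
   [z k <= |Phi|] and [\sum_k z k ^ 2 <= n |Phi|^2]; Hoelder's inequality with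
   exponents [r] and [r / (r - 1) >= 2] bounds it by
   [|C|_r n^((r-1)/r) |Phi|]. *)
From mathcomp Require Import all_boot all_order all_algebra.
From mathcomp Require Import complex finmap ring lra.
From mathcomp Require Import boolp classical_sets cardinality fsbigop.
From mathcomp Require Import reals ereal topology normedtype esum exp.
From mathcomp.analysis.showcase Require Import summability.
Require Import Defs.

Import Order.TTheory GRing.Theory Num.Theory.
Import numFieldNormedType.Exports.
Import ComplexField.Normc.

Local Open Scope classical_set_scope.
Local Open Scope ring_scope.
Local Open Scope complex_scope.

Set Implicit Arguments.
Unset Strict Implicit.
Unset Printing Implicit Defensive.

(** * Hilbert spaces with complex scalars and a real-valued norm *)

(** [DeltaPlus] sums over an arbitrary system [e], while the estimates live on the eigenvectors [x]
    of [C^* C]. For [r > 1] the norms of the terms need not be summable, so that both sums have the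
    same limit is a separate fact: it is obtained by truncating [C] to finitely many [x k], with an
    error controlled by the Hilbert-Schmidt tail uniformly in the finite subset of [e]. Accordingly
    every inequality is proved for finite partial sums, which are bounded operators, and reaches the
    limit along the net of finite subsets.

    Normal ordering leaves two scalar terms, the direct and the exchange contraction; each is at
    most [|C|_2^2], whence the factor 2. The number operator, an unbounded sum, is handled through
    its finite partial sums, which are symmetric and, on the [n]-particle space, bounded by [n].
    Bounds for separate [n] add up because pair creation keeps components of different particle
    number orthogonal. Since [adjoint], [schatten_norm] and [number_power] are defined by choice,
    each chosen value has to be identified. *)

Section complex_facts.
Variable R : realType.
Implicit Types z w : R[i].

Lemma normr_normc z : `|z| = (normc z)%:C.
Proof. by rewrite normc_def; case: z. Qed.

Lemma normc_ge0 z : 0 <= normc z.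
Proof. by case: z => a b; exact: sqrtr_ge0. Qed.

Lemma normc_sqr z : (normc z ^+ 2)%:C = z * conjc z.
Proof. by rewrite rmorphXn /= -normr_normc sqr_normc. Qed.

Lemma ReD z w : complex.Re (z + w) = complex.Re z + complex.Re w.
Proof. by case: z w => [a b] [c d]. Qed.

Lemma ReN z : complex.Re (- z) = - complex.Re z.
Proof. by case: z. Qed.

Lemma ReMr (t : R) z : complex.Re (t%:C * z) = t * complex.Re z.
Proof. by case: z => a b /=; rewrite mul0r subr0. Qed.

Lemma Re_conj z : complex.Re (conjc z) = complex.Re z.
Proof. by case: z. Qed.

Lemma Re_sum (I : Type) (s : seq I) (f : I -> R[i]) :
  complex.Re (\sum_(i <- s) f i) = \sum_(i <- s) complex.Re (f i).
Proof.
by elim: s => [|i s IH]; rewrite ?big_nil // !big_cons ReD IH.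
Qed.

Lemma Re_le_normc z : complex.Re z <= normc z.
Proof.
case: z => a b /=; apply: le_trans (ler_norm a) _.
by rewrite -sqrtr_sqr ler_sqrt ?addr_ge0 ?sqr_ge0 // lerDl sqr_ge0.
Qed.

Lemma normc_conj z : normc (conjc z) = normc z.
Proof. by case: z => a b /=; rewrite sqrrN. Qed.

Lemma normc_opp z : normc (- z) = normc z.
Proof. by case: z => a b /=; rewrite !sqrrN. Qed.

Lemma normc_eq0 z : (normc z == 0) = (z == 0).
Proof.
by apply/eqP/eqP => [/eq0_normc //|->]; rewrite normc0.
Qed.

Lemma normc_real (t : R) : normc t%:C = `|t|.
Proof. by rewrite /= expr0n addr0 sqrtr_sqr. Qed.

Lemma normcD z w : normc (z + w) <= normc z + normc w.
Proof. by rewrite -lecR rmorphD /= -!normr_normc ler_normD. Qed.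

Lemma normc_sum (I : Type) (s : seq I) (f : I -> R[i]) :
  normc (\sum_(i <- s) f i) <= \sum_(i <- s) normc (f i).
Proof.
elim: s => [|i s IH]; first by rewrite !big_nil normc0.
by rewrite !big_cons (le_trans (normcD _ _)) // lerD2l.
Qed.

Lemma conjCE z : Num.conj z = conjc z.
Proof. by []. Qed.

Lemma complex_eq z w :
  complex.Re z = complex.Re w -> complex.Im z = complex.Im w -> z = w.
Proof. by case: z w => [a b] [c d] /= -> ->. Qed.

End complex_facts.

Lemma sum_le_subset (R : numDomainType) (I : eqType) (s t : seq I) (f : I -> R) :
  uniq s -> uniq t -> {subset s <= t} -> (forall i, 0 <= f i) ->
  \sum_(i <- s) f i <= \sum_(i <- t) f i.
Proof.
move=> us ut st f0; rewrite [leRHS](bigID (mem s)) /=.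
have -> : \sum_(i <- t | i \in s) f i = \sum_(i <- s) f i.
  rewrite -big_filter; apply: perm_big; apply: uniq_perm => //.
    exact: filter_uniq.
  by move=> i; rewrite mem_filter; case: (boolP (i \in s)) => // /st.
by rewrite lerDl sumr_ge0.
Qed.

Section hilbert_basics.
Variables (R : realType) (H : hilbertType R).
Implicit Types (x y z : H) (c : R[i]).

(** The norm takes values in [R[i]]; its real part carries the same information and lives in an
    ordered field, where real arithmetic applies. *)
Definition nm x : R := complex.Re `|x|.

Lemma nmE x : `|x| = (nm x)%:C.
Proof. by rewrite RRe_real // normr_real. Qed.

Lemma nm_ge0 x : 0 <= nm x.
Proof. by rewrite -lecR -nmE normr_ge0. Qed.

Lemma nm0 : nm 0 = 0.
Proof. by rewrite /nm normr0. Qed.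

Lemma nm_eq0 x : (nm x == 0) = (x == 0).
Proof.
by rewrite -(normr_eq0 x) nmE -[0 in RHS]/(0%:C) (inj_eq (@complexI _)).
Qed.

Lemma nm_eq0P x : nm x = 0 -> x = 0.
Proof. by move/eqP; rewrite nm_eq0 => /eqP. Qed.

Lemma nmD x y : nm (x + y) <= nm x + nm y.
Proof. by rewrite -lecR rmorphD /= -!nmE ler_normD. Qed.

Lemma nmN x : nm (- x) = nm x.
Proof. by rewrite /nm normrN. Qed.

Lemma nmBC x y : nm (x - y) = nm (y - x).
Proof. by rewrite /nm distrC. Qed.

Lemma nmB_trans z x y : nm (x - y) <= nm (x - z) + nm (z - y).
Proof. by rewrite (le_trans _ (nmD _ _)) // addrA subrK. Qed.

Lemma nm_sum (I : Type) (s : seq I) (f : I -> H) :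
  nm (\sum_(i <- s) f i) <= \sum_(i <- s) nm (f i).
Proof.
elim: s => [|i s IH]; first by rewrite !big_nil nm0.
by rewrite !big_cons (le_trans (nmD _ _)) // lerD2l.
Qed.

Lemma nmZ c x : nm (c *: x) = normc c * nm x.
Proof.
by apply: (@complexI R); rewrite -nmE normrZ nmE normr_normc rmorphM.
Qed.

Lemma nmZr (t : R) x : nm (t%:C *: x) = `|t| * nm x.
Proof. by rewrite nmZ normc_real. Qed.

Lemma ipDr x y z : ip x (y + z) = ip x y + ip x z.
Proof. by have := ip_linear x 1 y z; rewrite scale1r mul1r. Qed.

Lemma ip0r x : ip x 0 = 0.
Proof. by apply: (addrI (ip x 0)); rewrite -ipDr !addr0. Qed.

Lemma ipZr c x y : ip x (c *: y) = c * ip x y.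
Proof. by have := ip_linear x c y 0; rewrite !addr0 ip0r addr0. Qed.

Lemma ipNr x y : ip x (- y) = - ip x y.
Proof. by rewrite -scaleN1r ipZr mulN1r. Qed.

Lemma ipBr x y z : ip x (y - z) = ip x y - ip x z.
Proof. by rewrite ipDr ipNr. Qed.

Lemma ip_sumr x (I : Type) (s : seq I) (f : I -> H) :
  ip x (\sum_(i <- s) f i) = \sum_(i <- s) ip x (f i).
Proof.
by elim: s => [|i s IH]; rewrite ?big_nil ?ip0r // !big_cons ipDr IH.
Qed.

Lemma ipDl x y z : ip (y + z) x = ip y x + ip z x.
Proof. by rewrite ip_conj ipDr rmorphD /= -!ip_conj. Qed.

Lemma ip0l x : ip 0 x = 0.
Proof. by rewrite ip_conj ip0r rmorph0. Qed.

Lemma ipZl c x y : ip (c *: y) x = conjc c * ip y x.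
Proof. by rewrite ip_conj ipZr rmorphM /= -ip_conj. Qed.

Lemma ipZreall (t : R) x y : ip (t%:C *: y) x = t%:C * ip y x.
Proof. by rewrite ipZl; rewrite [conjc _]conjc_real. Qed.

Lemma ipNl x y : ip (- y) x = - ip y x.
Proof. by rewrite ip_conj ipNr rmorphN /= -ip_conj. Qed.

Lemma ipBl x y z : ip (y - z) x = ip y x - ip z x.
Proof. by rewrite ipDl ipNl. Qed.

Lemma ip_suml x (I : Type) (s : seq I) (f : I -> H) :
  ip (\sum_(i <- s) f i) x = \sum_(i <- s) ip (f i) x.
Proof.
by elim: s => [|i s IH]; rewrite ?big_nil ?ip0l // !big_cons ipDl IH.
Qed.

Lemma ip_self x : ip x x = (nm x ^+ 2)%:C.
Proof. by rewrite ip_norm nmE rmorphXn. Qed.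

Lemma nm_sqr x : nm x ^+ 2 = complex.Re (ip x x).
Proof. by rewrite ip_self. Qed.

Lemma Re_ipC x y : complex.Re (ip x y) = complex.Re (ip y x).
Proof. by rewrite ip_conj Re_conj. Qed.

Lemma nm_sqrD x y :
  nm (x + y) ^+ 2 = nm x ^+ 2 + nm y ^+ 2 + 2 * complex.Re (ip x y).
Proof.
by rewrite !nm_sqr ipDr !ipDl !ReD (Re_ipC y x); ring.
Qed.

Lemma nm_sqrB x y :
  nm (x - y) ^+ 2 = nm x ^+ 2 + nm y ^+ 2 - 2 * complex.Re (ip x y).
Proof. by rewrite nm_sqrD nmN ipNr ReN; ring. Qed.

Lemma nm_le_sqr (t : R) x : 0 <= t -> nm x ^+ 2 <= t ^+ 2 -> nm x <= t.
Proof. by move=> t0; rewrite ler_pXn2r // nnegrE nm_ge0. Qed.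

Lemma Re_CauchySchwarz x y : complex.Re (ip x y) <= nm x * nm y.
Proof.
have [x0|x0] := eqVneq (nm x) 0.
  by rewrite x0 (nm_eq0P x0) ip0l mul0r.
have [y0|y0] := eqVneq (nm y) 0.
  by rewrite y0 (nm_eq0P y0) ip0r mulr0.
have st : 0 < nm x * nm y by rewrite mulr_gt0 // lt_neqAle eq_sym nm_ge0 ?x0 ?y0.
have : 0 <= nm ((nm y)%:C *: x - (nm x)%:C *: y) ^+ 2 by exact: sqr_ge0.
rewrite nm_sqrB !nmZr !ger0_norm ?nm_ge0 // ipZreall ipZr !ReMr.
move=> h; rewrite -(ler_pM2l st); nra.
Qed.

Lemma CauchySchwarz x y : normc (ip x y) <= nm x * nm y.
Proof.
have [/eqP e0|e0] := boolP (normc (ip x y) == 0).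
  by rewrite e0 mulr_ge0 ?nm_ge0.
have e1 : 0 < normc (ip x y) by rewrite lt_neqAle eq_sym e0 normc_ge0.
(* The factor [conjc (ip x y)] makes the inner product real, equal to [normc (ip x y) ^+ 2]. *)
have := Re_CauchySchwarz x (conjc (ip x y) *: y).
rewrite ipZr mulrC -normc_sqr /= nmZ normc_conj mulrCA expr2.
by rewrite ler_pM2l.
Qed.

Lemma orthogonal_nm_sqr_sum (I : eqType) (s : seq I) (f : I -> H) : uniq s ->
  (forall i j, i != j -> ip (f i) (f j) = 0) ->
  nm (\sum_(i <- s) f i) ^+ 2 = \sum_(i <- s) nm (f i) ^+ 2.
Proof.
move=> + orth; elim: s => [|i s IH] /=; first by rewrite !big_nil nm0 expr0n.
case/andP=> si us; rewrite !big_cons nm_sqrD IH // ip_sumr.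
rewrite [X in complex.Re X]big_seq [X in complex.Re X]big1 /= ?mulr0 ?addr0 //.
by move=> j js; apply: orth; apply: contraNneq si => ->.
Qed.

Lemma ip_orthonormal_sumr (I : choiceType) (e : I -> H) (s : seq I)
  (c : I -> R[i]) (j : I) : uniq s -> orthonormal e ->
  ip (e j) (\sum_(i <- s) c i *: e i) = if j \in s then c j else 0.
Proof.
move=> us oe; rewrite ip_sumr.
under eq_bigr do rewrite ipZr oe.
case: ifP => js.
  rewrite (bigD1_seq j) //= eqxx mulr1 big1 ?addr0 //.
  by move=> i ij; rewrite eq_sym (negPf ij) mulr0.
rewrite big_seq big1 // => i iS; have [jE|] := eqVneq j i; last by rewrite mulr0.
by rewrite jE iS in js.
Qed.

Definition proj (I : Type) (e : I -> H) (s : seq I) x :=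
  \sum_(i <- s) ip (e i) x *: e i.

Lemma nm_orthonormal (I : choiceType) (e : I -> H) i :
  orthonormal e -> nm (e i) = 1.
Proof.
move=> oe; have := congr1 (@complex.Re R) (oe i i).
rewrite eqxx ip_self /= => h.
by apply/eqP; rewrite -(@eqrXn2 _ 2) ?nm_ge0 // h expr1n.
Qed.

Lemma nm_orthonormal_sum (I : choiceType) (e : I -> H) (s : seq I)
  (c : I -> R[i]) : uniq s -> orthonormal e ->
  nm (\sum_(i <- s) c i *: e i) ^+ 2 = \sum_(i <- s) normc (c i) ^+ 2.
Proof.
move=> us oe; rewrite nm_sqr ip_suml Re_sum big_seq [RHS]big_seq.
apply: eq_bigr => i iS; rewrite ipZl ip_orthonormal_sumr // iS.
by rewrite mulrC -normc_sqr.
Qed.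

(** Pythagoras with arbitrary coefficients: [c i = ip (e i) x] yields Bessel's inequality, and the
    last sum, being nonnegative, shows that [proj] is the best approximation. *)
Lemma nm_sub_proj (I : choiceType) (e : I -> H) (s : seq I)
  (c : I -> R[i]) x : uniq s -> orthonormal e ->
  nm (x - \sum_(i <- s) c i *: e i) ^+ 2 =
  nm x ^+ 2 - \sum_(i <- s) normc (ip (e i) x) ^+ 2 +
  \sum_(i <- s) normc (ip (e i) x - c i) ^+ 2.
Proof.
move=> us oe; rewrite nm_sqrB nm_orthonormal_sum // ip_sumr Re_sum.
rewrite -addrA -[RHS]addrA; congr (_ + _).
rewrite mulr_sumr -!sumrN -!big_split /=; apply: eq_bigr => i _.
rewrite ipZr (ip_conj (e i) x); move: (ip _ _) (c i) => [a b] [u v] /=.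
by rewrite !sqr_sqrtr ?addr_ge0 ?sqr_ge0 //; ring.
Qed.

Lemma Bessel (I : choiceType) (e : I -> H) (s : seq I) x :
  uniq s -> orthonormal e ->
  \sum_(i <- s) normc (ip (e i) x) ^+ 2 <= nm x ^+ 2.
Proof.
move=> us oe; rewrite -subr_ge0.
have := nm_sub_proj (fun i => ip (e i) x) x us oe.
rewrite [X in _ - _ + X]big1 => [|i _]; last by rewrite subrr normc0 expr0n.
by rewrite addr0 => <-; exact: sqr_ge0.
Qed.

Lemma nm_sub_proj_le (I : choiceType) (e : I -> H) (s : seq I)
  (c : I -> R[i]) x : uniq s -> orthonormal e ->
  nm (x - proj e s x) <= nm (x - \sum_(i <- s) c i *: e i).
Proof.
move=> us oe; apply: nm_le_sqr; first exact: nm_ge0.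
rewrite !nm_sub_proj // [X in _ - _ + X <= _]big1 => [|i _].
  by rewrite addr0 lerDl sumr_ge0 // => i _; exact: sqr_ge0.
by rewrite subrr normc0 expr0n.
Qed.

End hilbert_basics.

(** * Nets of partial sums, closed spans and the Riesz representation *)

(** Closes the limit arguments: [c] may depend on anything but [eta]. If [t > 0], then [eta = 1]
    forces [c > 0], and [eta = t / (2 * c)] gives [t <= t / 2]. *)
Lemma le0_eps (R : realFieldType) (t c : R) :
  (forall eta, 0 < eta -> t <= eta * c) -> t <= 0.
Proof.
move=> h; rewrite leNgt; apply/negP => t0.
have c0 : 0 < c by have := h 1 ltr01; rewrite mul1r; exact: lt_le_trans.
have := h (t / (2 * c)); rewrite divr_gt0 ?mulr_gt0 // => /(_ isT).
rewrite invfM mulrA mulfVK ?gt_eqF //; lra.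
Qed.

Section net_convergence.
Variables (R : realType) (H : hilbertType R).
Implicit Types (x y z : H) (c : R[i]).

Lemma gt0_realE (eps : R[i]) : 0 < eps ->
  eps = (complex.Re eps)%:C /\ 0 < complex.Re eps.
Proof. by case: eps => a b; rewrite ltcE /= => /andP[/eqP -> ->]. Qed.

Lemma nm_lt x (eps : R) : (`|x| < eps%:C) = (nm x < eps).
Proof. by rewrite nmE ltcR. Qed.

(** Completeness without sequences: nested nonempty sets of vanishing diameter shrink to a point. It
    serves both the nets of partial sums and the sets of near-minimisers in the Riesz theorem. *)
Lemma complete_family (A : R -> set H) :
  (forall eps, 0 < eps -> A eps !=set0) ->
  (forall eps eps', 0 < eps -> eps <= eps' -> A eps `<=` A eps') ->
  (forall eps, 0 < eps -> exists2 d, 0 < d &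
     forall x y, A d x -> A d y -> nm (x - y) < eps) ->
  exists z, forall eps, 0 < eps -> exists2 d, 0 < d &
     forall x, A d x -> nm (z - x) < eps.
Proof.
move=> A0 Asub Adiam.
pose F := filter_from [set eps : R | 0 < eps] A.
have FF : ProperFilter F.
  apply: filter_from_proper; last by move=> eps; exact: A0.
  apply: filter_from_filter; first by exists 1 => /=.
  move=> d d' /= d0 d'0; exists (Num.min d d'); first by rewrite /= lt_min d0.
  by move=> x Ax; split; apply: Asub Ax; rewrite ?lt_min ?d0 // ge_min lexx ?orbT.
have /cauchy_cvg Fcvg : cauchy F.
  apply: cauchy_exP => eps /gt0_realE[-> /Adiam[d d0 dA]].
  have [x Ax] := A0 _ d0; exists x; exists d => // y Ay.
  by rewrite -ball_normE /= nm_lt; exact: dA.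
exists (lim F) => eps e0.
have /fcvgrPdist_lt/(_ eps%:C) := Fcvg; rewrite ltcR => /(_ e0)[d /= d0 dA].
by exists d => // x /dA /=; rewrite nm_lt.
Qed.

(** [S] is any function of finite subsets, not only a partial sum, because truncations such as
    [proj e K x] inside an operator also have to converge. *)
Definition netcvg (I : choiceType) (S : {fset I} -> H) l :=
  forall eps, 0 < eps -> exists K0 : {fset I},
    forall K : {fset I}, (K0 `<=` K)%fset -> nm (l - S K) < eps.

Lemma netcvg_sum (I : choiceType) (f : I -> H) l :
  netcvg (fun K : {fset I} => \sum_(i <- K) f i) l -> sum f = l.
Proof.
move=> fl; have FF : ProperFilter (@totally I) by exact: totally_filter.
apply: cvg_lim; first exact: norm_hausdorff.
apply/cvgrPdist_lt => eps /gt0_realE[-> /fl[K0 hK0]].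
exists K0 => // K /= /hK0; rewrite nm_lt /partial_sum big_seq_fsetE //.
Qed.

Lemma net_complete (I : choiceType) (S : {fset I} -> H) :
  (forall eps, 0 < eps -> exists K0 : {fset I},
    forall K : {fset I}, (K0 `<=` K)%fset -> nm (S K - S K0) < eps) ->
  exists l, netcvg S l.
Proof.
(* [A d] holds the values of [S] from which all later values differ by less than [d]; two of them
   are compared through the union of their index sets. *)
move=> cS; pose A d := [set x | exists2 K : {fset I}, x = S K &
  forall K' : {fset I}, (K `<=` K')%fset -> nm (S K' - S K) < d].
have [|||l hl] := @complete_family A.
- by move=> eps /cS[K0 hK0]; exists (S K0), K0.
- move=> d d' _ dd' x [K -> hK]; exists K => // K' /hK h; exact: lt_le_trans dd'.
- move=> eps e0; exists (eps / 2); first by rewrite divr_gt0.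
  move=> x y [K -> hK] [L -> hL].
  have := hK _ (fsubsetUl K L); have := hL _ (fsubsetUr K L).
  rewrite [nm (_ - S K)]nmBC.
  have := nmB_trans (S (K `|` L)%fset) (S K) (S L); lra.
exists l => eps e0; have [d d0 hd] := hl (eps / 2) (divr_gt0 e0 (ltr0Sn _ 1)).
have [|K0 hK0] := cS (Num.min d (eps / 2)).
  by rewrite lt_min d0 divr_gt0.
exists K0 => K /hK0; rewrite lt_min => /andP[_].
have /hd : A d (S K0).
  by exists K0 => // K' /hK0; rewrite lt_min => /andP[].
rewrite [nm (S K - _)]nmBC; have := nmB_trans (S K0) l (S K); lra.
Qed.

Lemma netcvgD (I : choiceType) (S T : {fset I} -> H) l m :
  netcvg S l -> netcvg T m -> netcvg (fun K => S K + T K) (l + m).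
Proof.
move=> Sl Tm eps e0; have e2 : 0 < eps / 2 by rewrite divr_gt0.
have [[K hK] [L hL]] := (Sl _ e2, Tm _ e2).
exists (K `|` L)%fset => M; rewrite fsubUset => /andP[/hK h1 /hL h2].
have := nmD (l - S M) (m - T M); rewrite addrACA -opprD; lra.
Qed.

Lemma netcvg_cst (I : choiceType) l : netcvg (fun _ : {fset I} => l) l.
Proof. by move=> eps e0; exists fset0 => K _; rewrite subrr nm0. Qed.

Lemma netcvg_bigsum (I : choiceType) (J : Type) (s : seq J)
  (S : J -> {fset I} -> H) (l : J -> H) :
  (forall j, netcvg (S j) (l j)) ->
  netcvg (fun K => \sum_(j <- s) S j K) (\sum_(j <- s) l j).
Proof.
move=> Sl; elim: s => [|j s IH].
  by rewrite big_nil => eps e0; exists fset0 => K _; rewrite big_nil subrr nm0.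
rewrite big_cons => eps /(netcvgD (Sl j) IH)[K0 hK0]; exists K0 => K /hK0.
by rewrite big_cons.
Qed.

Lemma netcvg_ext (I : choiceType) (S T : {fset I} -> H) l :
  netcvg S l -> (forall K, S K = T K) -> netcvg T l.
Proof. by move=> Sl ST eps /Sl[K0 hK0]; exists K0 => K /hK0; rewrite ST. Qed.

Lemma netcvg_nm_le (I : choiceType) (S : {fset I} -> H) l (b : R) :
  netcvg S l -> (forall K, nm (S K) <= b) -> nm l <= b.
Proof.
move=> Sl Sb; rewrite -subr_le0; apply: (@le0_eps _ _ 1) => eta /Sl[K0].
move=> /(_ _ (fsubset_refl _)) h; rewrite mulr1; have := Sb K0.
have := nmD (l - S K0) (S K0); rewrite subrK; lra.
Qed.

End net_convergence.

Section spans.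
Variables (R : realType) (H : hilbertType R).
Implicit Types (x y z : H) (c : R[i]) (A P : set H).

Lemma lspan_ind A P : P 0 ->
  (forall c x y, P x -> P y -> P (c *: x + y)) -> A `<=` P -> lspan A `<=` P.
Proof.
move=> P0 Plin AP _ [n [c [v [Av ->]]]].
elim: (index_enum _) => [|k s IH]; first by rewrite big_nil.
by rewrite big_cons; apply: Plin => //; exact/AP.
Qed.

Lemma lspan_seqP A x : lspan A x <-> exists2 s : seq (R[i] * H),
  (forall p, p \in s -> A p.2) & x = \sum_(p <- s) p.1 *: p.2.
Proof.
split=> [[n [c [v [Av ->]]]]|[s As ->]].
  exists [seq (c k, v k) | k <- enum 'I_n].
    by move=> p /mapP[k _ ->]; exact: Av.
  by rewrite big_map big_enum.
exists (size s), (fun k => (tnth (in_tuple s) k).1).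
exists (fun k => (tnth (in_tuple s) k).2); split=> [k|].
  by apply: As; exact: mem_tnth.
by rewrite (big_tnth _ _ s).
Qed.

Lemma lspan0 A : lspan A 0.
Proof. by apply/lspan_seqP; exists [::]; rewrite ?big_nil. Qed.

Lemma sub_lspan A : A `<=` lspan A.
Proof.
move=> x Ax; apply/lspan_seqP; exists [:: (1, x)].
  by move=> p; rewrite inE => /eqP ->.
by rewrite big_seq1 scale1r.
Qed.

Lemma lspan_lin A c x y : lspan A x -> lspan A y -> lspan A (c *: x + y).
Proof.
move=> /lspan_seqP[s As ->] /lspan_seqP[t At ->]; apply/lspan_seqP.
exists ([seq (c * p.1, p.2) | p <- s] ++ t).
  by move=> p; rewrite mem_cat => /orP[/mapP[q /As + ->]|/At].
rewrite big_cat big_map scaler_sumr; congr (_ + _).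
by apply: eq_bigr => p _; rewrite scalerA.
Qed.

Lemma cspanP A x : cspan A x <->
  forall eps, 0 < eps -> exists2 y, lspan A y & nm (x - y) < eps.
Proof.
split=> [Ax eps e0|Ax B].
  have [|y [Ay yB]] := Ax [set y | `|x - y| < eps%:C].
    by apply/nbhs_normP; exists eps%:C; rewrite /= ?ltcR.
  by exists y; rewrite // -nm_lt.
move/nbhs_normP=> [eps /= /gt0_realE[-> /Ax[y Ay xy]] eB].
by exists y; split=> //; apply: eB; rewrite /= nm_lt.
Qed.

Lemma sub_cspan A : lspan A `<=` cspan A.
Proof. by move=> x Ax; apply/cspanP => eps e0; exists x; rewrite ?subrr ?nm0. Qed.

Lemma cspan_lin A c x y : cspan A x -> cspan A y -> cspan A (c *: x + y).
Proof.
move=> /cspanP Ax /cspanP Ay; apply/cspanP => eps e0.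
have c1 : 0 < normc c + 1 by rewrite ltr_wpDl ?normc_ge0.
have [|x' Ax' hx] := Ax (eps / 2 / (normc c + 1)); first by rewrite !divr_gt0.
have [|y' Ay' hy] := Ay (eps / 2); first by rewrite divr_gt0.
exists (c *: x' + y'); first exact: lspan_lin.
rewrite opprD addrACA -scalerBr.
apply: le_lt_trans (nmD _ _) _; rewrite nmZ.
rewrite ltr_pdivlMr // in hx.
by have := nm_ge0 (x - x'); have := normc_ge0 c; nra.
Qed.

Lemma cspan_closed A x :
  (forall eps, 0 < eps -> exists2 y, cspan A y & nm (x - y) < eps) -> cspan A x.
Proof.
move=> h; apply/cspanP => eps e0; have e2 : 0 < eps / 2 by rewrite divr_gt0.
have [y /cspanP/(_ _ e2)[z Az yz] xy] := h _ e2; exists z => //.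
have := nmB_trans y x z; lra.
Qed.

Lemma cspan_bigsum A (I : Type) (s : seq I) (f : I -> H) :
  (forall i, cspan A (f i)) -> cspan A (\sum_(i <- s) f i).
Proof.
move=> Af; elim: s => [|i s IH].
  by rewrite big_nil; exact/sub_cspan/lspan0.
by rewrite big_cons -[f i]scale1r; exact: cspan_lin.
Qed.

End spans.

Section riesz.
Variables (R : realType) (H : hilbertType R).
Implicit Types (x y z : H) (c : R[i]).

(* The representing vector minimises [|x|^2 - 2 Re (phi x)]. *)
Theorem Riesz (phi : H -> R[i]) (M : R) :
  (forall c x y, phi (c *: x + y) = c * phi x + phi y) ->
  (forall x, normc (phi x) <= M * nm x) ->
  exists z, forall x, phi x = ip z x.
Proof.
move=> lin bd.
have phiD x y : phi (x + y) = phi x + phi y.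
  by have := lin 1 x y; rewrite scale1r mul1r.
have phi0 : phi 0 = 0 by apply: (addrI (phi 0)); rewrite -phiD !addr0.
have phiZ c x : phi (c *: x) = c * phi x.
  by have := lin c x 0; rewrite !addr0 phi0 addr0.
pose J x := nm x ^+ 2 - 2 * complex.Re (phi x).
have Jlb x : - (M ^+ 2) <= J x.
  have := Re_le_normc (phi x); have := bd x; rewrite /J.
  have := sqr_ge0 (nm x - M); nra.
have infJ : has_inf (range J).
  by split; [exists (J 0), 0 | exists (- (M ^+ 2)) => _ [x _ <-]].
pose m := inf (range J).
have Jm x : m <= J x by apply: ge_inf; [case: infJ|exists x].
(* The parallelogram identity for [J]: since [J] at the midpoint is at least [m], two
   near-minimisers are close to each other. *)
have Jpar x y :
    nm (x - y) ^+ 2 = 2 * J x + 2 * J y - 4 * J (2^-1%:C *: (x + y)).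
  rewrite /J nmZr phiZ ReMr phiD ReD exprMn nm_sqrB nm_sqrD.
  by rewrite ger0_norm ?invr_ge0 //; field.
have [|||z hz] := @complete_family _ H (fun eps => [set x | J x < m + eps]).
- move=> eps e0; have [_ [x _ <-] Jx] := inf_adherent e0 infJ; by exists x.
- by move=> e e' _ ee' x /= /lt_le_trans; apply; rewrite lerD2l.
- move=> eps e0; exists (eps ^+ 2 / 8); first by rewrite divr_gt0 ?exprn_gt0.
  move=> x y /= Jx Jy; rewrite -(ltr_pXn2r (ltn0Sn 1)) ?nnegrE ?nm_ge0 ?ltW //.
  by rewrite Jpar; have := Jm (2^-1%:C *: (x + y)); have := exprn_gt0 2 e0; lra.
have JD x h (t : R) : J (x + t%:C *: h) = J x + t ^+ 2 * nm h ^+ 2 +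
    2 * t * (complex.Re (ip x h) - complex.Re (phi h)).
  rewrite /J nm_sqrD nmZr ipZr phiD phiZ ReD !ReMr exprMn real_normK ?num_real //.
  by ring.
have near_crit x eps h : 0 < eps -> J x < m + eps ^+ 2 ->
    `|complex.Re (ip x h) - complex.Re (phi h)| <= eps * nm h.
  move=> e0 Jx; have [h0|h0] := eqVneq (nm h) 0.
    by rewrite (nm_eq0P h0) ip0r phi0 subrr normr0 nm0 mulr0.
  have hp : 0 < nm h by rewrite lt_neqAle eq_sym h0 nm_ge0.
  (* On the line through [x] along [h], [J] is quadratic in the parameter; at its minimum
     [- b / nm h ^+ 2] it has dropped by [(b / nm h) ^+ 2]. *)
  set b := _ - _; have := Jm (x + (- b / nm h ^+ 2)%:C *: h); rewrite JD -/b.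
  have -> : J x + (- b / nm h ^+ 2) ^+ 2 * nm h ^+ 2 + 2 * (- b / nm h ^+ 2) * b
      = J x - (b / nm h) ^+ 2 by field.
  move=> mb; rewrite -ler_pdivrMr // -(ger0_norm (nm_ge0 h)) -normf_div.
  by rewrite -(ler_pXn2r (ltn0Sn 1)) ?nnegrE ?(ltW e0) // real_normK ?num_real //; lra.
(* Some [x] is both nearly minimal, hence nearly critical, and close to [z]; the criticality
   relation passes from [x] to [z]. *)
have ReE h : complex.Re (phi h) = complex.Re (ip z h).
  apply/eqP; rewrite eq_sym -subr_eq0 -normr_le0; apply: (@le0_eps _ _ (2 * nm h)).
  move=> eta eta0; have [d d0 hd] := hz eta eta0.
  have [|_ [x _ <-] Jx] := @inf_adherent _ (range J) (Num.min d (eta ^+ 2)) _ infJ.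
    by rewrite lt_min d0 exprn_gt0.
  rewrite -/m in Jx.
  have /hd zx : J x < m + d by apply: lt_le_trans Jx _; rewrite lerD2l ge_min lexx.
  have /near_crit-/(_ h eta0) : J x < m + eta ^+ 2.
    by apply: lt_le_trans Jx _; rewrite lerD2l ge_min lexx orbT.
  have : `|complex.Re (ip (z - x) h)| <= eta * nm h.
    rewrite ler_norml; apply/andP; split; last first.
      by apply: le_trans (Re_CauchySchwarz _ _) _; have := nm_ge0 h; nra.
    rewrite -lerN2 opprK -ReN -ipNl; apply: le_trans (Re_CauchySchwarz _ _) _.
    by rewrite nmN; have := nm_ge0 h; nra.
  rewrite ipBl ReD ReN => h1 h2; apply: le_trans (ler_distD (complex.Re (ip x h)) _ _) _.
  by lra.
exists z => x; apply: complex_eq; first exact: ReE.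
(* Multiplication by ['i] turns equality of real parts into equality of imaginary parts. *)
have := ReE ('i *: x); rewrite phiZ ipZr.
by case: (phi x) (ip z x) => [a b] [c d] /=; rewrite !mul0r !mul1r !sub0r => /oppr_inj.
Qed.

Section bounded_operators.
Variable T : H -> H.
Hypothesis bT : bounded_operator T.

Lemma bopD x y : T (x + y) = T x + T y.
Proof. by have [/(_ 1 x y)] := bT; rewrite !scale1r. Qed.

Lemma bop0 : T 0 = 0.
Proof. by apply: (addrI (T 0)); rewrite -bopD !addr0. Qed.

Lemma bopZ c x : T (c *: x) = c *: T x.
Proof. by have [/(_ c x 0)] := bT; rewrite bop0 !addr0. Qed.

Lemma bopN x : T (- x) = - T x.
Proof. by rewrite -scaleN1r bopZ scaleN1r. Qed.

Lemma bop_sum (I : Type) (s : seq I) (f : I -> H) :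
  T (\sum_(i <- s) f i) = \sum_(i <- s) T (f i).
Proof.
by elim: s => [|i s IH]; rewrite ?big_nil ?bop0 // !big_cons bopD IH.
Qed.

Lemma bop_bound : exists2 M : R, 0 < M & forall x, nm (T x) <= M * nm x.
Proof.
have [_ [M hM]] := bT; exists (Num.max M 1); first by rewrite lt_max ltr01 orbT.
move=> x; have := hM x; rewrite !nmE -rmorphM lecR => /le_trans; apply.
by rewrite ler_wpM2r ?nm_ge0 // le_max lexx.
Qed.

(** [adjoint] is chosen by [get], so a representing vector must exist; Riesz applies to
    [ip y (T x)], which is linear in [x], and conjugation gives the stated side. *)
Lemma adjointE x y : ip (T x) y = ip x (adjoint T y).
Proof.
have [M M0 hM] := bop_bound.
have [||z hz] := @Riesz (fun x => ip y (T x)) (nm y * M).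
- by move=> c u v; rewrite bopD bopZ ipDr ipZr.
- move=> u; apply: le_trans (CauchySchwarz _ _) _.
  by rewrite -mulrA ler_wpM2l ?nm_ge0.
have : exists z, forall x, ip (T x) y = ip x z.
  by exists z => u; rewrite ip_conj hz -ip_conj.
by rewrite /adjoint => /getPex; apply.
Qed.

End bounded_operators.

End riesz.

Section orthonormal_bases.
Variables (R : realType) (H : hilbertType R) (I : choiceType) (e : I -> H).
Hypothesis ce : complete_orthonormal e.
Implicit Types (x y z : H) (c : R[i]).

(** A vector of the linear span equals its projection for all large [K]; by best approximation
    [proj e K x] is then at least as close to [x] as that vector. *)
Lemma netcvg_proj x : netcvg (fun K : {fset I} => proj e K x) x.
Proof.
have [oe spe] := ce.
have fin : lspan (range e) `<=` [set y | exists K0 : {fset I},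
    forall K : {fset I}, (K0 `<=` K)%fset -> proj e K y = y].
  apply: lspan_ind => [|c y z [K hK] [L hL]|_ [i _ <-]].
  - by exists fset0 => K _; rewrite /proj big1 // => i _; rewrite ip0r scale0r.
  - exists (K `|` L)%fset => M; rewrite fsubUset => /andP[/hK hy /hL hz].
    rewrite -[in RHS]hy -[in RHS]hz /proj scaler_sumr -big_split /=.
    by apply: eq_bigr => i _; rewrite ipDr ipZr scalerDl scalerA.
  exists [fset i]%fset => K; rewrite fsub1set => iK; rewrite /proj.
  rewrite (bigD1_seq i) ?fset_uniq //= oe eqxx scale1r big1 ?addr0 //.
  by move=> j ij; rewrite oe (negPf ij) scale0r.
have /cspanP xe : cspan (range e) x by rewrite spe.
move=> eps /xe[y /fin[K0 hK0] xy]; exists K0 => K /hK0 hy.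
apply: le_lt_trans xy; rewrite -[in leRHS]hy.
by apply: nm_sub_proj_le => //; exact: fset_uniq.
Qed.

Lemma Parseval_lower x eps : 0 < eps -> exists K0 : {fset I},
  forall K : {fset I}, (K0 `<=` K)%fset ->
  nm x ^+ 2 - eps < \sum_(i <- K) normc (ip (e i) x) ^+ 2.
Proof.
(* A distance below both [eps] and 1 has its square below [eps]. *)
move=> e0; have [|K0 hK0] := @netcvg_proj x (Num.min eps 1).
  by rewrite lt_min e0 ltr01.
exists K0 => K /hK0; rewrite lt_min => /andP[h1 h2].
have [oe _] := ce.
have := nm_sub_proj (fun i => ip (e i) x) x (fset_uniq K) oe.
rewrite [X in _ = _ - _ + X]big1 => [|i _]; last by rewrite subrr normc0 expr0n.
rewrite -/(proj e K x) addr0; have := nm_ge0 (x - proj e K x); nra.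
Qed.

End orthonormal_bases.

(** * Gram matrices, bounded operators and conjugations *)

Lemma sum_CauchySchwarz (R : realFieldType) (I : Type) (s : seq I)
  (f g : I -> R) :
  (\sum_(i <- s) f i * g i) ^+ 2 <=
  (\sum_(i <- s) f i ^+ 2) * (\sum_(i <- s) g i ^+ 2).
Proof.
elim: s => [|i s IH]; first by rewrite !big_nil expr0n mulr0.
rewrite !big_cons.
have A0 : 0 <= \sum_(j <- s) f j ^+ 2 by apply: sumr_ge0 => j _; exact: sqr_ge0.
have B0 : 0 <= \sum_(j <- s) g j ^+ 2 by apply: sumr_ge0 => j _; exact: sqr_ge0.
move: (\sum_(j <- s) f j * _) (\sum_(j <- s) f j ^+ 2)
  (\sum_(j <- s) g j ^+ 2) (f i) (g i) IH A0 B0 => S A B a b IH A0 B0.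
(* The cross term follows from [S ^+ 2 <= A * B] and the arithmetic-geometric mean inequality,
   compared after squaring. *)
suff h : 2 * (S * (a * b)) <= A * b ^+ 2 + B * a ^+ 2 by nra.
have t0 : 0 <= A * b ^+ 2 + B * a ^+ 2 by apply: addr_ge0; apply: mulr_ge0 => //; exact: sqr_ge0.
apply: le_trans (ler_norm _) _.
rewrite -(ler_pXn2r (ltn0Sn 1)) ?nnegrE ?normr_ge0 // real_normK ?num_real //.
have h1 : S ^+ 2 * (a * b) ^+ 2 <= A * B * (a * b) ^+ 2.
  by rewrite ler_wpM2r ?sqr_ge0.
have := sqr_ge0 (A * b ^+ 2 - B * a ^+ 2).
have -> : (A * b ^+ 2 - B * a ^+ 2) ^+ 2 =
  (A * b ^+ 2 + B * a ^+ 2) ^+ 2 - 4 * (A * B * (a * b) ^+ 2) by ring.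
have -> : (2 * (S * (a * b))) ^+ 2 = 4 * (S ^+ 2 * (a * b) ^+ 2) by ring.
lra.
Qed.

Section gram.
Variables (R : realType) (L F : hilbertType R).

(* The entrywise product of two Gram matrices is positive semidefinite: split
   off the component of every [z i] along the first vector. *)
Lemma gram_product_ge0 (I : Type) (s : seq I) (z : I -> L) (w : I -> F) :
  0 <= complex.Re
    (\sum_(i <- s) \sum_(j <- s) ip (z j) (z i) * ip (w i) (w j)).
Proof.
elim: s z => [|k s IH] z; first by rewrite big_nil.
have drop z' : z' k = 0 ->
    \sum_(i <- k :: s) \sum_(j <- k :: s) ip (z' j) (z' i) * ip (w i) (w j) =
    \sum_(i <- s) \sum_(j <- s) ip (z' j) (z' i) * ip (w i) (w j).
  move=> zk; rewrite big_cons big1 ?add0r => [|j _]; last by rewrite zk ip0r mul0r.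
  by apply: eq_bigr => i _; rewrite big_cons zk ip0l mul0r add0r.
have [zk|zk] := eqVneq (z k) 0; first by rewrite drop.
pose n2 := nm (z k) ^+ 2; have n0 : n2 != 0 by rewrite sqrf_eq0 nm_eq0.
pose c i := (n2^-1)%:C * ip (z k) (z i).
pose z' i := z i - c i *: z k.
have zk' : z' k = 0.
  by rewrite /z' /c ip_self -rmorphM /= mulVf // scale1r subrr.
have orth i : ip (z k) (z' i) = 0.
  rewrite /z' ipBr ipZr /c ip_self mulrAC -rmorphM /= mulVf //.
  by rewrite mul1r subrr.
have orth' i : ip (z' i) (z k) = 0.
  by rewrite ip_conj orth; exact: conjc0.
have zz i : z i = c i *: z k + z' i by rewrite addrC subrK.
move: z' zk' orth orth' zz => z' zk' orth orth' zz.
have zE i j : ip (z j) (z i) = n2%:C * (conjc (c j) * c i) + ip (z' j) (z' i).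
  rewrite (zz i) (zz j) ipDr !ipDl !ipZr !ipZl ip_self orth orth'.
  by rewrite !mulr0 addr0 add0r mulrA mulrC [c i * _]mulrC.
(* The components along [z k] contribute [n2] times a squared norm in [F]; the remainder [z']
   vanishes at [k], which leaves a sum over [s] for the induction. *)
have -> : \sum_(i <- k :: s) \sum_(j <- k :: s) ip (z j) (z i) * ip (w i) (w j)
  = n2%:C * ip (\sum_(i <- k :: s) conjc (c i) *: w i)
      (\sum_(i <- k :: s) conjc (c i) *: w i) +
    \sum_(i <- k :: s) \sum_(j <- k :: s) ip (z' j) (z' i) * ip (w i) (w j).
  rewrite ip_suml mulr_sumr -big_split /=; apply: eq_bigr => i _.
  rewrite ip_sumr mulr_sumr -big_split /=; apply: eq_bigr => j _.
  by rewrite zE ipZl ipZr conjcK; ring.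
rewrite drop // ReD addr_ge0 // ip_self -rmorphM /=.
by rewrite mulr_ge0 ?sqr_ge0.
Qed.

End gram.

Section bounded_operator_facts.
Variables (R : realType) (H : hilbertType R).
Implicit Types (T : H -> H).

Lemma bounded_operatorI T (M : R) :
  (forall (c : R[i]) x y, T (c *: x + y) = c *: T x + T y) ->
  (forall x, nm (T x) <= M * nm x) -> bounded_operator T.
Proof.
by move=> lin hM; split=> //; exists M => x; rewrite !nmE -rmorphM lecR.
Qed.

Lemma bounded_operator_comp T U :
  bounded_operator T -> bounded_operator U -> bounded_operator (T \o U).
Proof.
move=> bT bU; have [M M0 hM] := bop_bound bT; have [N N0 hN] := bop_bound bU.
apply: (@bounded_operatorI _ (M * N)) => [c x y|x] /=.
  by rewrite (bopD bU) (bopZ bU) (bopD bT) (bopZ bT).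
apply: le_trans (hM _) _; rewrite -mulrA ler_wpM2l ?hN //; exact: ltW.
Qed.

Lemma bounded_operator_sum (I : Type) (s : seq I) (T : I -> H -> H) :
  (forall i, bounded_operator (T i)) ->
  bounded_operator (fun x => \sum_(i <- s) T i x).
Proof.
move=> bT; have [M hM] : exists M : I -> R, forall i x, nm (T i x) <= M i * nm x.
  have /choice[M hM] : forall i, exists M : R, forall x, nm (T i x) <= M * nm x.
    by move=> i; have [M _ hM] := bop_bound (bT i); exists M.
  by exists M.
apply: (@bounded_operatorI _ (\sum_(i <- s) M i)) => [c x y|x].
  rewrite scaler_sumr -big_split /=; apply: eq_bigr => i _.
  by rewrite (bopD (bT i)) (bopZ (bT i)).
apply: le_trans (nm_sum _ _) _; rewrite mulr_suml; exact: ler_sum.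
Qed.

Lemma bop_cspan T (A B : set H) x : bounded_operator T ->
  (forall y, A y -> cspan B (T y)) -> cspan A x -> cspan B (T x).
Proof.
move=> bT AB /cspanP Ax; have [M M0 hM] := bop_bound bT.
have AB' : lspan A `<=` [set y | cspan B (T y)].
  apply: lspan_ind => [|c y z By Bz|y /AB //] /=.
    by rewrite (bop0 bT); exact/sub_cspan/lspan0.
  by rewrite (bopD bT) (bopZ bT); exact: cspan_lin.
apply: cspan_closed => eps e0; have [|y /AB' By xy] := Ax (eps / M).
  by rewrite divr_gt0.
exists (T y) => //; rewrite -(bopN bT) -(bopD bT).
by apply: le_lt_trans (hM _) _; rewrite mulrC -ltr_pdivlMr.
Qed.

End bounded_operator_facts.

(** Only additivity and a bound are asked of [g], so that maps passing through the antilinear [cj]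
    are covered. *)
Lemma netcvg_map (R : realType) (H K : hilbertType R) (I : choiceType)
  (S : {fset I} -> H) (l : H) (g : H -> K) (M : R) :
  (forall x y, g (x - y) = g x - g y) -> (forall x, nm (g x) <= M * nm x) ->
  netcvg S l -> netcvg (g \o S) (g l).
Proof.
move=> gB gM Sl eps e0; have [|K0 hK0] := Sl (eps / (`|M| + 1)).
  by rewrite divr_gt0 // ltr_wpDl ?normr_ge0.
exists K0 => J /hK0; rewrite ltr_pdivlMr ?ltr_wpDl ?normr_ge0 //= -gB => h.
apply: le_lt_trans (gM _) _; apply: le_lt_trans h; rewrite mulrC.
by rewrite ler_wpM2l ?nm_ge0 // (le_trans (ler_norm _)) // lerDl.
Qed.

Section conjugations.
Variables (R : realType) (L : hilbertType R) (cj : L -> L).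
Hypothesis hcj : conjugation cj.
Implicit Types (x y : L) (c : R[i]).

Lemma cjK x : cj (cj x) = x.
Proof. exact: cj_involutive. Qed.

Lemma cjD x y : cj (x + y) = cj x + cj y.
Proof.
have := cj_antilinear hcj 1 x y.
by rewrite conjCE [conjc 1]conjc1 !scale1r.
Qed.

Lemma cj0 : cj 0 = 0.
Proof. by apply: (addrI (cj 0)); rewrite -cjD !addr0. Qed.

Lemma cjZ c x : cj (c *: x) = conjc c *: cj x.
Proof. by have := cj_antilinear hcj c x 0; rewrite cj0 !addr0. Qed.

Lemma cjB x y : cj (x - y) = cj x - cj y.
Proof.
by apply: (addIr (cj y)); rewrite -cjD !subrK.
Qed.

Lemma cj_sum (I : Type) (s : seq I) (f : I -> L) :
  cj (\sum_(i <- s) f i) = \sum_(i <- s) cj (f i).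
Proof.
by elim: s => [|i s IH]; rewrite ?big_nil ?cj0 // !big_cons cjD IH.
Qed.

Lemma nm_cj x : nm (cj x) = nm x.
Proof. by rewrite /nm (cj_isometry hcj). Qed.

(** Polarisation of the isometry gives the real parts; with ['i *: y] in place of [y], antilinearity
    flips the sign of the imaginary part, hence the exchanged arguments. *)
Lemma ip_cj x y : ip (cj x) (cj y) = ip y x.
Proof.
have ReE u v : complex.Re (ip (cj u) (cj v)) = complex.Re (ip u v).
  have := nm_sqrD (cj u) (cj v); rewrite -cjD !nm_cj nm_sqrD; lra.
apply: complex_eq; first by rewrite ReE Re_ipC.
have := ReE x ('i *: y); rewrite cjZ !ipZr (ip_conj x y).
case: (ip (cj x) _) (ip x y) => [a b] [c d] /=.
by rewrite !mul0r !mul1r mulN1r; lra.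
Qed.

(** In the pairs [ad (C (x k)) (ad (cj (x k)) _)] the inner vectors are conjugated; they too must
    form a basis in which particles can be counted. *)
Lemma complete_orthonormal_cj (I : choiceType) (x : I -> L) :
  complete_orthonormal x -> complete_orthonormal (cj \o x).
Proof.
move=> cx; have [ox _] := cx; split=> [i j|].
  by rewrite /= ip_cj ox eq_sym.
apply/seteqP; split=> // f _; apply/cspanP => eps e0.
have [K hK] := netcvg_proj cx (cj f) e0.
exists (cj (proj x K (cj f))); last first.
  by rewrite -[X in X - _]cjK -cjB nm_cj; apply: hK; exact: fsubset_refl.
rewrite /proj cj_sum; elim: (enum_fset K) => [|i s IH].
  by rewrite big_nil; exact: lspan0.
by rewrite big_cons cjZ; apply: lspan_lin => //; apply: sub_lspan; exists i.
Qed.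

End conjugations.

(** * Canonical anticommutation relations and pair creation *)

Section fock.
Variables (R : realType) (L F : hilbertType R) (cj : L -> L).
Variables (a ad : L -> F -> F) (Omega : F).
Hypotheses (hcj : conjugation cj) (hF : fock_representation cj a ad Omega).
Implicit Types (f g u v : L) (x y z : F) (c : R[i]).

(* The adjoint of [ad f], hence antilinear in [f]. *)
Definition annihilation f : F -> F := a (cj f).
Local Notation al := annihilation.

Lemma bounded_al f : bounded_operator (al f).
Proof. exact: (fock_a_bounded hF). Qed.

Lemma bounded_ad f : bounded_operator (ad f).
Proof. exact: (fock_ad_bounded hF). Qed.

Lemma ip_al f x y : ip (al f x) y = ip x (ad f y).
Proof. by rewrite (adjointE (bounded_al f)) (fock_adjoint hF) (cjK hcj). Qed.

Lemma ip_ad f x y : ip (ad f x) y = ip x (al f y).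
Proof. by rewrite ip_conj -ip_al -ip_conj. Qed.

Lemma al_ad f g x : al f (ad g x) = ip f g *: x - ad g (al f x).
Proof.
have := fock_aad hF (cj f) g x.
by rewrite (cjK hcj) -/(al f _) -/(al f _) => <-; rewrite addrK.
Qed.

Lemma al_al f g x : al f (al g x) = - al g (al f x).
Proof. by apply/eqP; rewrite -addr_eq0 (fock_aa hF). Qed.

Lemma ad_lin c f g x : ad (c *: f + g) x = c *: ad f x + ad g x.
Proof. exact: (fock_ad_linear hF). Qed.

Lemma adDf f g x : ad (f + g) x = ad f x + ad g x.
Proof. by have := ad_lin 1 f g x; rewrite !scale1r. Qed.

Lemma ad0f x : ad 0 x = 0.
Proof. by apply: (addrI (ad 0 x)); rewrite -adDf !addr0. Qed.

Lemma adZf c f x : ad (c *: f) x = c *: ad f x.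
Proof. by have := ad_lin c f 0 x; rewrite ad0f !addr0. Qed.

Lemma adBf f g x : ad (f - g) x = ad f x - ad g x.
Proof. by apply: (addIr (ad g x)); rewrite -adDf !subrK. Qed.

Lemma ad_sumf (I : Type) (s : seq I) (f : I -> L) x :
  ad (\sum_(i <- s) f i) x = \sum_(i <- s) ad (f i) x.
Proof.
by elim: s => [|i s IH]; rewrite ?big_nil ?ad0f // !big_cons adDf IH.
Qed.

(** The anticommutator of [al f] and [ad f] as a quadratic form; it bounds both operators by [nm f]
    at once. *)
Lemma nm_ad_al f x : nm (ad f x) ^+ 2 + nm (al f x) ^+ 2 = nm f ^+ 2 * nm x ^+ 2.
Proof.
rewrite !nm_sqr ip_ad ip_al al_ad ipBr ipZr !ip_self ReD ReN subrK.
by rewrite -rmorphM.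
Qed.

Lemma nm_ad f x : nm (ad f x) <= nm f * nm x.
Proof.
apply: nm_le_sqr; first by rewrite mulr_ge0 ?nm_ge0.
by rewrite exprMn -nm_ad_al lerDl sqr_ge0.
Qed.

Lemma nm_al f x : nm (al f x) <= nm f * nm x.
Proof.
apply: nm_le_sqr; first by rewrite mulr_ge0 ?nm_ge0.
by rewrite exprMn -nm_ad_al lerDr sqr_ge0.
Qed.

Section pair_sums.
Variables (I : choiceType) (u v : I -> L).
Implicit Type s : seq I.

(** The families [u] and [v] stay general, since the estimates are needed for the eigenvectors and
    also for [C] truncated in the basis [e]. *)
Definition pair_create s x := \sum_(k <- s) ad (u k) (ad (v k) x).
Definition pair_annihilate s x := \sum_(k <- s) al (v k) (al (u k) x).

(** Normal ordering: two double contractions, the fully ordered quartic term, and four single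
    contractions with overall sign minus. *)
Lemma ip_pair_create j k x :
  ip (ad (u j) (ad (v j) x)) (ad (u k) (ad (v k) x)) =
  (ip (u j) (u k) * ip (v j) (v k) - ip (v j) (u k) * ip (u j) (v k)) * ip x x
  + ip (al (v k) (al (u k) x)) (al (v j) (al (u j) x))
  - (ip (u j) (u k) * ip (al (v k) x) (al (v j) x)
     - ip (v j) (u k) * ip (al (v k) x) (al (u j) x)
     - ip (u j) (v k) * ip (al (u k) x) (al (v j) x)
     + ip (v j) (v k) * ip (al (u k) x) (al (u j) x)).
Proof.
rewrite !ip_ad !al_ad.
rewrite !(bopD (bounded_al _), bopN (bounded_al _), bopZ (bounded_al _), al_ad).
rewrite !(bopD (bounded_ad _), bopN (bounded_ad _), bopZ (bounded_ad _)).
rewrite !(ipDr, ipNr, ipZr) -!ip_al.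
by ring.
Qed.

(** The four contractions become one product of Gram matrices over a doubled index set, with [u]
    paired to [al v] and [v] to [- al u]; this sign produces the two negative terms. *)
Lemma pair_quadratic_form_ge0 s x : 0 <= complex.Re (\sum_(k <- s) \sum_(j <- s)
  (ip (u j) (u k) * ip (al (v k) x) (al (v j) x)
     - ip (v j) (u k) * ip (al (v k) x) (al (u j) x)
     - ip (u j) (v k) * ip (al (u k) x) (al (v j) x)
     + ip (v j) (v k) * ip (al (u k) x) (al (u j) x))).
Proof.
pose z (p : bool * I) := if p.1 then u p.2 else v p.2.
pose w (p : bool * I) := if p.1 then al (v p.2) x else - al (u p.2) x.
have := gram_product_ge0
  ([seq (true, k) | k <- s] ++ [seq (false, k) | k <- s]) z w.
rewrite big_cat /= !big_map -big_split /=; congr (0 <= complex.Re _).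
apply: eq_bigr => k _; rewrite !big_cat /= !big_map -!big_split /=.
by apply: eq_bigr => j _; rewrite /z /w /= !(ipNl, ipNr); ring.
Qed.

(** Dropping the nonnegative quadratic terms leaves the direct contraction [C1], equal to the sum of
    [nm (u k) ^+ 2] by orthonormality of [v], and the exchange contraction [C2], bounded by the same
    sum. *)
Lemma pair_create_le s x : uniq s ->
  orthonormal v ->
  nm (pair_create s x) ^+ 2 <= nm (pair_annihilate s x) ^+ 2
    + 2 * (\sum_(k <- s) nm (u k) ^+ 2) * nm x ^+ 2.
Proof.
move=> us ov.
pose C1 := \sum_(k <- s) \sum_(j <- s) ip (u j) (u k) * ip (v j) (v k).
pose C2 := \sum_(k <- s) \sum_(j <- s) ip (v j) (u k) * ip (u j) (v k).
have E : complex.Re (ip (pair_create s x) (pair_create s x)) <=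
    complex.Re (C1 - C2) * nm x ^+ 2 + nm (pair_annihilate s x) ^+ 2.
  have := pair_quadratic_form_ge0 s x; set Q := (X in complex.Re X) => Q0.
  have -> : ip (pair_create s x) (pair_create s x) = (C1 - C2) * ip x x
      + ip (pair_annihilate s x) (pair_annihilate s x) - Q.
    rewrite /C1 /C2 /Q [LHS]ip_sumr [ip (pair_annihilate s x) _]ip_suml.
    rewrite -sumrB mulr_suml -big_split -sumrB; apply: eq_bigr => k _.
    rewrite [LHS]ip_suml ip_sumr -sumrB mulr_suml -big_split -sumrB /=.
    by apply: eq_bigr => j _; rewrite ip_pair_create.
  rewrite !ip_self !ReD ReN mulrC ReMr /= mulrC; lra.
rewrite [X in X <= _]nm_sqr; apply: le_trans E _.
rewrite addrC lerD2l ler_wpM2r ?sqr_ge0 //.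
have -> : C1 = (\sum_(k <- s) nm (u k) ^+ 2)%:C.
  rewrite /C1 rmorph_sum big_seq [RHS]big_seq; apply: eq_bigr => k ks.
  rewrite (bigD1_seq k) //= ov eqxx mulr1 big1 ?addr0 ?ip_self //.
  by move=> j jk; rewrite ov (negPf jk) mulr0.
(* Each product of overlaps is at most half the sum of their squares; both halves are then summed by
   Bessel's inequality in [v]. *)
have C2le : normc C2 <= \sum_(k <- s) nm (u k) ^+ 2.
  apply: le_trans (normc_sum _ _) _.
  apply: (@le_trans _ _ (\sum_(k <- s) \sum_(j <- s)
    (2^-1 * normc (ip (v j) (u k)) ^+ 2 + 2^-1 * normc (ip (v k) (u j)) ^+ 2))).
    apply: ler_sum => k _; apply: le_trans (normc_sum _ _) _.
    apply: ler_sum => j _; rewrite normcM (ip_conj (v k)) normc_conj.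
    have := sqr_ge0 (normc (ip (v j) (u k)) - normc (ip (v k) (u j))); nra.
  under eq_bigr do rewrite big_split /=.
  rewrite big_split /= [X in _ + X]exchange_big /= -big_split /=.
  apply: ler_sum => k _; rewrite -!mulr_sumr.
  by have := Bessel (u k) us ov; lra.
rewrite ReD ReN /=; have := Re_le_normc (- C2).
by rewrite ReN normc_opp; lra.
Qed.

(** Anticommuting brings [al (v k)] next to [x], where the number operator controls it; the outer
    [al (u k)] costs only its norm. *)
Lemma pair_annihilate_le s x :
  nm (pair_annihilate s x) <= \sum_(k <- s) nm (u k) * nm (al (v k) x).
Proof.
apply: le_trans (nm_sum _ _) _; apply: ler_sum => k _.
by rewrite al_al nmN nm_al.
Qed.

End pair_sums.

End fock.

(** * The number operator on particle spaces *)

Section number.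
Variables (R : realType) (L F : hilbertType R) (cj : L -> L).
Variables (a ad : L -> F -> F) (Omega : F).
Hypotheses (hcj : conjugation cj) (hF : fock_representation cj a ad Omega).
Implicit Types (f g u v : L) (x y z : F) (c : R[i]).

Local Notation al := (annihilation cj a).
Local Notation fockn := (particle_space ad Omega).
Local Notation crea n := (creations ad Omega @` [set fs : seq L | size fs = n]).
Local Notation bal := (bounded_al hF).
Local Notation bad := (bounded_ad hF).

Lemma particle_space_ad n f x : fockn n x -> fockn n.+1 (ad f x).
Proof.
apply: (bop_cspan (bad f)) => _ [fs /= sz <-]; apply/sub_cspan/sub_lspan.
by exists (f :: fs); rewrite //= sz.
Qed.

Section basis.
Variables (I : choiceType) (e : I -> L).
Hypothesis ce : complete_orthonormal e.

(** The bounded, symmetric truncations through which the number operator is handled. *)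
Definition number_partial (s : seq I) x := \sum_(i <- s) ad (e i) (al (e i) x).

Lemma bounded_number_partial s : bounded_operator (number_partial s).
Proof.
apply: bounded_operator_sum => i.
exact: (bounded_operator_comp (bad (e i)) (bal (e i))).
Qed.
Local Notation bnum := bounded_number_partial.

Lemma ip_number_partial s x y : ip x (number_partial s y) =
  \sum_(i <- s) ip (al (e i) x) (al (e i) y).
Proof. by rewrite ip_sumr; apply: eq_bigr => i _; rewrite (ip_al hcj hF). Qed.

Lemma ip_number_partialC s x y :
  ip x (number_partial s y) = ip (number_partial s x) y.
Proof.
rewrite ip_number_partial ip_suml; apply: eq_bigr => i _.
by rewrite (ip_ad hcj hF).
Qed.

(** The commutator with [ad f] is creation of the projected vector; as the projections tend to [f],
    each creation raises the limiting eigenvalue by one. *)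
Lemma number_partial_ad s f x :
  number_partial s (ad f x) = ad (proj e s f) x + ad f (number_partial s x).
Proof.
rewrite /proj (ad_sumf hF) (bop_sum (bad f)) -big_split /=.
apply: eq_bigr => i _; rewrite (al_ad hcj hF) (bopD (bad _)) (bopZ (bad _)).
rewrite (bopN (bad _)) (adZf hF); congr (_ + _).
by apply/eqP; rewrite eq_sym -addr_eq0 (fock_adad hF).
Qed.

Lemma number_creations fs : netcvg
  (fun K : {fset I} => number_partial K (creations ad Omega fs))
  ((size fs)%:R%:C *: creations ad Omega fs).
Proof.
elim: fs => [|f fs IH].
  rewrite /= mulr0n rmorph0 scale0r; apply: (@netcvg_ext _ _ _ (fun=> 0)) => [|K]; first exact: netcvg_cst.
  apply/esym; rewrite /number_partial big1 // => i _.
  by rewrite /annihilation (fock_vacuum hF) (bop0 (bad _)).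
set x := creations ad Omega fs in IH *.
have -> : (size (f :: fs))%:R%:C *: creations ad Omega (f :: fs) =
    ad f x + ad f ((size fs)%:R%:C *: x).
  by rewrite (bopZ (bad f)) /= -/x -{2}[ad f x]scale1r -scalerDl -natr1 addrC rmorphD.
apply: (@netcvg_ext _ _ _
  (fun K => ad (proj e (enum_fset K) f) x + ad f (number_partial K x))); last first.
  by move=> K; rewrite /= -number_partial_ad.
apply: netcvgD.
  apply: (@netcvg_map _ _ _ _ _ f (ad^~ x) (nm x)) (netcvg_proj ce f) => [u v|u].
    by rewrite (adBf hF).
  by rewrite mulrC; exact: (nm_ad hcj hF).
apply: (@netcvg_map _ _ _ _ _ _ (ad f) (nm f)) IH => [y z|y].
  by rewrite (bopD (bad f)) (bopN (bad f)).
exact: (nm_ad hcj hF).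
Qed.

Lemma number_span n x : lspan (crea n) x ->
  netcvg (fun K : {fset I} => number_partial K x) (n%:R%:C *: x).
Proof.
apply: (lspan_ind (P := [set x | netcvg _ _])) => [|c y z hy hz|_ [fs /= <- <-]] /=.
- rewrite scaler0; apply: (@netcvg_ext _ _ _ (fun=> 0)) => [|K].
    exact: netcvg_cst.
  by rewrite (bop0 (bnum _)).
- apply: (@netcvg_ext _ _ _ (fun K => c *: number_partial K y + number_partial K z)); last first.
    by move=> K; rewrite (bopD (bnum _)) (bopZ (bnum _)).
  rewrite scalerDr scalerA mulrC -scalerA; apply: netcvgD => //.
  apply: (@netcvg_map _ _ _ _ _ _ (fun y => c *: y) (normc c)) hy => [u v|u].
    by rewrite scalerBr.
  by rewrite nmZ.
exact: number_creations.
Qed.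

(** The left side is the expectation of [number_partial K], which grows with [K] and tends to the
    right side. *)
Lemma sum_nm_al_span n (K : {fset I}) x : lspan (crea n) x ->
  \sum_(i <- K) nm (al (e i) x) ^+ 2 <= n%:R * nm x ^+ 2.
Proof.
move=> /number_span hx; rewrite -subr_le0.
apply: (@le0_eps _ _ (nm x)) => eta /hx[K0 hK0].
have hJ := hK0 _ (fsubsetUl K0 K); set J := (K0 `|` K)%fset in hJ.
apply: (@le_trans _ _ (\sum_(i <- J) nm (al (e i) x) ^+ 2 - n%:R * nm x ^+ 2)).
  rewrite lerD2r sum_le_subset ?fset_uniq // => [i|i]; last exact: sqr_ge0.
  by rewrite !inE => ->; rewrite orbT.
have -> : \sum_(i <- J) nm (al (e i) x) ^+ 2 = complex.Re (ip x (number_partial J x)).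
  by rewrite ip_number_partial Re_sum; apply: eq_bigr => i _; rewrite -nm_sqr.
have -> : n%:R * nm x ^+ 2 = complex.Re (ip x (n%:R%:C *: x)).
  by rewrite ipZr ReMr nm_sqr.
rewrite -ReN -ReD -ipBr; apply: le_trans (Re_CauchySchwarz _ _) _.
by rewrite mulrC nmBC ler_wpM2r ?nm_ge0 // ltW.
Qed.

Lemma sum_nm_al_le n (K : {fset I}) x : fockn n x ->
  \sum_(i <- K) nm (al (e i) x) ^+ 2 <= n%:R * nm x ^+ 2.
Proof.
move=> /cspanP hx; rewrite -subr_le0; have [oe _] := ce.
pose N : R := \sum_(i <- K) 1.
(* [K] is fixed, so the error may carry its cardinality [N]. Replacing [x] by [y] within [d <= 1]
   changes [nm x ^+ 2] by at most [d * (2 * nm x + 1)] and each summand by at most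
   [d * (2 * nm x + 3)]. *)
apply: (@le0_eps _ _ (n%:R * (2 * nm x + 1) + N * (2 * nm x + 3))).
move=> eta eta0; pose d := Num.min eta 1.
have d0 : 0 < d by rewrite lt_min eta0 ltr01.
have de : d <= eta by rewrite ge_min lexx.
have d1 : d <= 1 by rewrite ge_min lexx orbT.
have [y /sum_nm_al_span-/(_ K) hy xy] := hx d d0.
have yx : nm y <= nm x + d.
  by have := nmB_trans x y 0; rewrite !subr0 nmBC; lra.
have nme i := nm_orthonormal i oe.
have step i : nm (al (e i) x) ^+ 2 <= nm (al (e i) y) ^+ 2 + d * (2 * nm x + 3).
  have h1 : nm (al (e i) y) <= nm y by have := nm_al hcj hF (e i) y; rewrite nme mul1r.
  have h2 : nm (al (e i) x) <= nm (al (e i) y) + d.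
    have := nm_al hcj hF (e i) (x - y); rewrite nme mul1r.
    rewrite (bopD (bal _)) (bopN (bal _)) => h.
    by have := nmB_trans (al (e i) y) (al (e i) x) 0; rewrite !subr0; lra.
  have := nm_ge0 (al (e i) x); have := nm_ge0 (al (e i) y); nra.
have sumle : \sum_(i <- K) nm (al (e i) x) ^+ 2 <=
    n%:R * nm y ^+ 2 + N * (d * (2 * nm x + 3)).
  apply: (@le_trans _ _ (\sum_(i <- K) (nm (al (e i) y) ^+ 2 + d * (2 * nm x + 3)))).
    by apply: ler_sum => i _; exact: step.
  rewrite big_split /=; apply: lerD; first exact: hy.
  by rewrite /N mulr_suml; apply: ler_sum => i _; rewrite mul1r.
have n0 : 0 <= n%:R :> R by [].
have N0 : 0 <= N by apply: sumr_ge0.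
have x0 := nm_ge0 x; have y0 := nm_ge0 y.
have : n%:R * nm y ^+ 2 <= n%:R * (nm x ^+ 2 + d * (2 * nm x + 1)).
  by rewrite ler_wpM2l //; nra.
have : n%:R * (d * (2 * nm x + 1)) <= n%:R * (eta * (2 * nm x + 1)).
  by rewrite ler_wpM2l // ler_wpM2r //; lra.
have : N * (d * (2 * nm x + 3)) <= N * (eta * (2 * nm x + 3)).
  by rewrite ler_wpM2l // ler_wpM2r //; lra.
lra.
Qed.

Lemma particle_space_number_partial n (K : {fset I}) x :
  fockn n x -> fockn n (number_partial K x).
Proof.
apply: (bop_cspan (bnum K)) => _ [fs /= <- <-].
elim: fs => [|f fs IH].
  rewrite /number_partial /= big1 => [|i _]; first exact/sub_cspan/lspan0.
  by rewrite /annihilation (fock_vacuum hF) (bop0 (bad _)).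
rewrite /= number_partial_ad -[ad (proj _ _ _) _]scale1r; apply: cspan_lin.
  by apply/sub_cspan/sub_lspan; exists (proj e K f :: fs).
exact: particle_space_ad.
Qed.

(** Uniformity in [K] extends the eigenvalue equation from the span to its closure. Cauchy-Schwarz
    needs the counting bound for [x] and for its image, which is again an [n]-particle vector. *)
Lemma nm_number_partial n (K : {fset I}) x :
  fockn n x -> nm (number_partial K x) <= n%:R * nm x.
Proof.
move=> hx; set y := number_partial K x.
have hy : fockn n y by exact: particle_space_number_partial.
have [y0|y0] := eqVneq (nm y) 0; first by rewrite y0 mulr_ge0 ?nm_ge0.
have yp : 0 < nm y by rewrite lt_neqAle eq_sym y0 nm_ge0.
have h1 : nm y ^+ 2 <= \sum_(i <- K) nm (al (e i) y) * nm (al (e i) x).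
  rewrite nm_sqr {2}/y ip_number_partial Re_sum.
  by apply: ler_sum => i _; exact: Re_CauchySchwarz.
have h2 := sum_CauchySchwarz K (fun i => nm (al (e i) y)) (fun i => nm (al (e i) x)).
have h3 := sum_nm_al_le K hx; have h4 := sum_nm_al_le K hy.
have h5 : (nm y ^+ 2) ^+ 2 <= (n%:R * nm y ^+ 2) * (n%:R * nm x ^+ 2).
  apply: (@le_trans _ _ ((\sum_(i <- K) nm (al (e i) y) * nm (al (e i) x)) ^+ 2)).
    by rewrite ler_pXn2r ?nnegrE ?sqr_ge0 // (le_trans _ h1) ?sqr_ge0.
  apply: le_trans h2 _; apply: ler_pM => //; apply: sumr_ge0 => i _; exact: sqr_ge0.
apply: nm_le_sqr; first by rewrite mulr_ge0 ?nm_ge0.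
rewrite -(ler_pM2l (exprn_gt0 2 yp)) -expr2 (le_trans h5) //.
by rewrite exprMn; have -> : n%:R * nm y ^+ 2 * (n%:R * nm x ^+ 2) =
  nm y ^+ 2 * (n%:R ^+ 2 * nm x ^+ 2) by ring.
Qed.

Lemma netcvg_number n x : fockn n x ->
  netcvg (fun K : {fset I} => number_partial K x) (n%:R%:C *: x).
Proof.
(* Two errors of size [n%:R * nm (x - y)] occur, one from the limit and one from the partial sum;
   together they stay within [eps / 2]. *)
move=> hx eps e0; pose d := eps / 2 / (2 * n%:R + 1).
have c0 : 0 < 2 * n%:R + 1 :> R by rewrite ltr_wpDl ?mulr_ge0.
have d0 : 0 < d by rewrite !divr_gt0.
have /cspanP/(_ d d0)[y hy xy] := hx.
have [K0 hK0] := number_span hy (divr_gt0 e0 (ltr0Sn _ 1)).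
exists K0 => K /hK0 h.
have hyx : fockn n (y - x).
  rewrite addrC -scaleN1r; apply: cspan_lin => //; exact: sub_cspan.
have := nm_number_partial K hyx.
rewrite (bopD (bnum K)) (bopN (bnum K)) [nm (y - x)]nmBC => h2.
have h3 : nm (n%:R%:C *: x - n%:R%:C *: y) = n%:R * nm (x - y).
  by rewrite -scalerBr nmZr ger0_norm.
apply: le_lt_trans (nmB_trans (n%:R%:C *: y) _ _) _; rewrite h3.
have := nmB_trans (number_partial K y) (n%:R%:C *: y) (number_partial K x).
have n0 : 0 <= n%:R :> R by [].
have : 2 * n%:R * nm (x - y) <= eps / 2.
  have := nm_ge0 (x - y); rewrite ltr_pdivlMr // in xy; lra.
lra.
Qed.

(** Eigenvectors of a symmetric operator for distinct eigenvalues, with the limit replaced by a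
    single symmetric [number_partial M] that nearly has both eigenvalues. *)
Lemma particle_space_orthogonal n m x y :
  fockn n x -> fockn m y -> n != m -> ip x y = 0.
Proof.
move=> /netcvg_number hx /netcvg_number hy nm'.
apply/eqP; rewrite -normc_eq0 eq_le normc_ge0 andbT.
have k0 : 0 < `|m%:R - n%:R| :> R by rewrite normr_gt0 subr_eq0 eqr_nat eq_sym.
rewrite -(pmulr_rle0 _ k0); apply: (@le0_eps _ _ (nm x + nm y)) => eta e0.
have [[K hK] [J hJ]] := (hx _ e0, hy _ e0).
have {hK} h1 := hK _ (fsubsetUl K J); have {hJ} h2 := hJ _ (fsubsetUr K J).
set M := (K `|` J)%fset in h1 h2.
rewrite -normc_real -normcM.
have -> : (m%:R - n%:R)%:C * ip x y =
    ip x (m%:R%:C *: y - number_partial M y) -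
    ip (n%:R%:C *: x - number_partial M x) y.
  by rewrite ipBr ipBl ip_number_partialC ipZr ipZreall rmorphB /=; ring.
apply: le_trans (normcD _ _) _; rewrite normc_opp.
have := CauchySchwarz x (m%:R%:C *: y - number_partial M y).
have := CauchySchwarz (n%:R%:C *: x - number_partial M x) y.
have := nm_ge0 x; have := nm_ge0 y; nra.
Qed.

End basis.
End number.

(** * Singular values and Schatten norms *)

Section esum_real.
Variables (R : realType) (J : choiceType) (f : J -> R).
Hypothesis f0 : forall j, 0 <= f j.

Lemma esum_ge_fset (K : {fset J}) :
  ((\sum_(j <- K) f j)%:E <= esum [set: J] (fun j => (f j)%:E))%E.
Proof.
apply: esum_ge; exists [set` K]; first by split=> //; exact: finite_fset.
by rewrite fsbig_finite ?finite_fset //= set_fsetK sumEFin.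
Qed.

Lemma esum_le_fset (t : R) : (forall K : {fset J}, \sum_(j <- K) f j <= t) ->
  (esum [set: J] (fun j => (f j)%:E) <= t%:E)%E.
Proof.
move=> ft; apply: ge_ereal_sup => _ [A [finA _] <-].
by rewrite fsbig_finite //= sumEFin lee_fin.
Qed.

Lemma esum_real_ge0 : (0 <= esum [set: J] (fun j => (f j)%:E))%E.
Proof. by apply: esum_ge0 => j _; rewrite lee_fin. Qed.

Hypothesis fin : (esum [set: J] (fun j => (f j)%:E) < +oo)%E.

Lemma esum_fineK :
  (fine (esum [set: J] (fun j => (f j)%:E)))%:E = esum [set: J] (fun j => (f j)%:E).
Proof. by rewrite fineK // ge0_fin_numE ?esum_real_ge0. Qed.

Lemma sum_le_fine_esum (K : {fset J}) :
  \sum_(j <- K) f j <= fine (esum [set: J] (fun j => (f j)%:E)).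
Proof. by rewrite -lee_fin esum_fineK esum_ge_fset. Qed.

(** Some finite [K0] comes within [eps] of the supremum, so a finite set disjoint from it adds at
    most [eps]. *)
Lemma esum_tail (eps : R) : 0 < eps -> exists K0 : {fset J},
  forall K : {fset J}, \sum_(j <- (K `\` K0)%fset) f j <= eps.
Proof.
move=> e0; have := @ub_ereal_sup_adherent R
  [set (\sum_(j \in A) (f j)%:E)%E | A in fsets [set: J]] eps e0.
rewrite -[ereal_sup _]/(esum [set: J] (fun j => (f j)%:E)) -esum_fineK.
move=> /(_ isT)[_ [A [finA _] <-]]; rewrite fsbig_finite //= sumEFin -EFinB lte_fin.
set K0 := fset_set A => h; exists K0 => K.
have := sum_le_fine_esum (K0 `|` (K `\` K0))%fset.
rewrite (perm_big (enum_fset K0 ++ enum_fset (K `\` K0)%fset)) /=; last first.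
  apply: uniq_perm; rewrite ?fset_uniq //.
    rewrite cat_uniq !fset_uniq andbT /=; apply/hasPn => j.
    by rewrite inE => /andP[].
  by move=> j; rewrite mem_cat !inE.
rewrite big_cat /=; lra.
Qed.

End esum_real.

Section singular_values.
Variables (R : realType) (L : hilbertType R) (C : L -> L).
Hypothesis bC : bounded_operator C.

(* Hence the matrix of squared overlaps intertwines two systems of singular
   values, and their power sums agree. *)
Lemma singular_value_overlap (J J' : choiceType) (mu : J -> R) (mu' : J' -> R)
  (x : J -> L) (x' : J' -> L) j k :
  (forall j, 0 <= mu j) -> (forall k, 0 <= mu' k) ->
  (forall j, adjoint C (C (x j)) = (mu j ^+ 2)%:C *: x j) ->
  (forall k, adjoint C (C (x' k)) = (mu' k ^+ 2)%:C *: x' k) ->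
  ip (x j) (x' k) != 0 -> mu j = mu' k.
Proof.
move=> m0 m0' hx hx' ne.
have h1 : ip (C (x j)) (C (x' k)) = (mu' k ^+ 2)%:C * ip (x j) (x' k).
  by rewrite (adjointE bC) hx' ipZr.
have h2 : ip (C (x j)) (C (x' k)) = (mu j ^+ 2)%:C * ip (x j) (x' k).
  by rewrite ip_conj (adjointE bC) hx -ip_conj ipZreall.
have /complexI h : (mu' k ^+ 2)%:C = (mu j ^+ 2)%:C.
  by apply: (mulIf ne); rewrite -h1.
by apply/eqP; rewrite -(@eqrXn2 _ 2) ?h.
Qed.

Lemma common_Parseval_lower (J : choiceType) (x : J -> L) (s : seq L) eps :
  complete_orthonormal x -> 0 < eps -> exists K : {fset J}, forall y, y \in s ->
  nm y ^+ 2 - eps < \sum_(j <- K) normc (ip (x j) y) ^+ 2.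
Proof.
move=> cx e0; elim: s => [|y s [K hK]]; first by exists fset0.
have [M hM] := Parseval_lower cx y e0; exists (M `|` K)%fset => z.
rewrite inE => /orP[/eqP -> |/hK/lt_le_trans]; first exact/hM/fsubsetUl.
apply; apply: sum_le_subset => [||i|i]; rewrite ?fset_uniq ?sqr_ge0 //.
by rewrite inE => ->; rewrite orbT.
Qed.

(** For each [k] the squared overlaps sum to nearly 1 by Parseval; nonzero ones allow [mu' k] to be
    replaced by [mu j], and for each [j] the overlaps sum to at most 1 by Bessel. *)
Lemma singular_values_sum_le (J J' : choiceType) (mu : J -> R) (mu' : J' -> R)
  (r t : R) : singular_values C mu -> singular_values C mu' ->
  (forall K : {fset J}, \sum_(j <- K) mu j `^ r <= t) ->
  forall K : {fset J'}, \sum_(k <- K) mu' k `^ r <= t.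
Proof.
move=> [m0 [x cx hx]] [m0' [x' [ox' spx'] hx']] hK K'.
rewrite -subr_le0; apply: (@le0_eps _ _ (\sum_(k <- K') mu' k `^ r)) => eta e0.
have [K hK0] := common_Parseval_lower (map x' (enum_fset K')) cx e0.
have n1 k : nm (x' k) ^+ 2 = 1 by rewrite nm_orthonormal // expr1n.
have h : (1 - eta) * \sum_(k <- K') mu' k `^ r <= t.
  apply: le_trans (hK K).
  apply: (@le_trans _ _ (\sum_(k <- K') \sum_(j <- K)
      mu j `^ r * normc (ip (x' k) (x j)) ^+ 2)).
    rewrite mulr_sumr big_seq [leRHS]big_seq; apply: ler_sum => k kK'.
    have := hK0 (x' k) (map_f x' kK'); rewrite n1 => /ltW.
    move=> /(ler_wpM2r (powR_ge0 (mu' k) r)) /le_trans; apply.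
    rewrite mulr_suml; apply: ler_sum => j _.
    rewrite [ip (x' k) _]ip_conj normc_conj mulrC.
    have [->|ne] := eqVneq (ip (x j) (x' k)) 0.
      by rewrite normc0 expr0n !mulr0.
    by rewrite (singular_value_overlap m0 m0' hx hx' ne).
  rewrite exchange_big /=; apply: ler_sum => j _; rewrite -mulr_sumr.
  rewrite ler_piMr ?powR_ge0 //; apply: le_trans (Bessel _ (fset_uniq _) ox') _.
  by have [ox _] := cx; rewrite nm_orthonormal // expr1n.
rewrite mulrBl mul1r in h; lra.
Qed.

Lemma singular_values_esum_le (J J' : choiceType) (mu : J -> R) (mu' : J' -> R)
  (r : R) : singular_values C mu -> singular_values C mu' ->
  (esum [set: J'] (fun j => (mu' j `^ r)%:E) <=
   esum [set: J] (fun j => (mu j `^ r)%:E))%E.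
Proof.
move=> h h'; have p0 j : 0 <= mu j `^ r by exact: powR_ge0.
have [fin|] := boolP (esum [set: J] (fun j => (mu j `^ r)%:E) < +oo)%E; last first.
  by rewrite -leNgt leye_eq => /eqP ->; exact: leey.
rewrite -(esum_fineK p0 fin); apply: esum_le_fset => K.
by apply: (singular_values_sum_le h h') => M; exact: sum_le_fine_esum.
Qed.

(** Identifies the value chosen by [get] with the one computed from any given system of singular
    values. *)
Lemma schatten_normE (J : choiceType) (mu : J -> R) (r : R) :
  singular_values C mu ->
  schatten_norm r C = fine (esum [set: J] (fun j => (mu j `^ r)%:E)) `^ r^-1.
Proof.
move=> h; rewrite /schatten_norm.
have : exists v : R, exists (J : choiceType) (mu : J -> R),
    singular_values C mu /\
    v = fine (esum [set: J] (fun j => (mu j `^ r)%:E)) `^ r^-1.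
  by eexists; exists J, mu; split; [exact: h|reflexivity].
move=> /(@getPex _ [set v : R | _])[J' [mu' [h' ->]]].
congr (fine _ `^ _); apply/eqP.
by rewrite eq_le !singular_values_esum_le.
Qed.

(** Translates the Schatten class into finite sums: since [nm (C (x j)) = mu j] and the images
    [C (x j)] are orthogonal, the later estimates can work with [x] alone. *)
Lemma schatten_svd (r : R) : 1 <= r <= 2 -> schatten r C ->
  exists (J : choiceType) (x : J -> L), [/\ complete_orthonormal x,
    forall i j, i != j -> ip (C (x i)) (C (x j)) = 0,
    forall K : {fset J}, \sum_(j <- K) nm (C (x j)) `^ r <= schatten_norm r C `^ r,
    forall K : {fset J}, \sum_(j <- K) nm (C (x j)) ^+ 2 <= schatten_norm 2 C ^+ 2 &
    forall eps, 0 < eps -> exists K0 : {fset J},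
      forall K : {fset J}, \sum_(j <- (K `\` K0)%fset) nm (C (x j)) ^+ 2 <= eps].
Proof.
move=> /andP[r1 r2] [_ [J [mu [hmu fin]]]].
have [m0 [x cx hx]] := hmu; have [ox _] := cx.
have muE j : nm (C (x j)) = mu j.
  have := congr1 (@complex.Re R) (ip_self (C (x j))).
  rewrite (adjointE bC) hx ipZr ox eqxx mulr1 /= => h.
  by apply/eqP; rewrite -(@eqrXn2 _ 2) ?nm_ge0 // -h.
have [M M0 hM] := bop_bound bC.
have muM j : mu j <= M.
  by rewrite -muE (le_trans (hM _)) // nm_orthonormal // mulr1.
(* Singular values are at most [M] and [2 - r >= 0], so the operator is also Hilbert-Schmidt. *)
have mu2 j : mu j `^ 2 <= M `^ (2 - r) * mu j `^ r.
  have -> : mu j `^ 2 = mu j `^ (2 - r) * mu j `^ r.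
    by rewrite -powRD subrK // pnatr_eq0.
  rewrite ler_wpM2r ?powR_ge0 // ge0_ler_powR ?nnegrE ?subr_ge0 //.
  exact: ltW.
have pr j : 0 <= mu j `^ r by exact: powR_ge0.
have p2 j : 0 <= mu j `^ 2 by exact: powR_ge0.
have fin2 : (esum [set: J] (fun j => (mu j `^ 2)%:E) < +oo)%E.
  apply: (@le_lt_trans _ _ (M `^ (2 - r) *
    fine (esum [set: J] (fun j => (mu j `^ r)%:E)))%:E); last exact: ltry.
  apply: esum_le_fset => K.
  apply: le_trans (ler_sum _ (fun j _ => mu2 j)) _; rewrite -mulr_sumr.
  rewrite ler_wpM2l ?powR_ge0 //; exact: (sum_le_fine_esum pr fin).
have sq j : mu j `^ 2 = nm (C (x j)) ^+ 2 by rewrite powR_mulrn // muE.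
have normE (p : R) : 0 < p -> schatten_norm p C `^ p =
    fine (esum [set: J] (fun j => (mu j `^ p)%:E)).
  move=> p0; rewrite (schatten_normE p hmu) -powRrM mulVf ?gt_eqF // powRr1 //.
  by rewrite fine_ge0 // esum_real_ge0 // => j; exact: powR_ge0.
exists J, x; split=> // [i j ij|K|K|eps e0].
- by rewrite (adjointE bC) hx ipZr ox (negPf ij) mulr0.
- under eq_bigr do rewrite muE.
  rewrite normE; last by lra.
  exact: sum_le_fine_esum.
- under eq_bigr do rewrite -sq.
  rewrite -powR_mulrn; last by rewrite (schatten_normE 2 hmu) powR_ge0.
  rewrite normE //; exact: sum_le_fine_esum.
have [K0 hK0] := esum_tail p2 fin2 e0; exists K0 => K.
by under eq_bigr do rewrite -sq.
Qed.

End singular_values.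

(** * Convergence of the pair creation operator *)

(** Young's inequality termwise for variables normalised by [A] and [c * B]; the two normalised sums
    contribute at most [r^-1] and [q^-1]. *)
Lemma weighted_Hoelder (R : realType) (I : eqType) (s : seq I) (mu z : I -> R)
  (r A N c : R) : 1 < r <= 2 -> 0 <= A -> 0 <= N -> 0 <= c ->
  (forall i, 0 <= mu i) -> (forall i, 0 <= z i <= c) ->
  \sum_(i <- s) mu i `^ r <= A `^ r ->
  \sum_(i <- s) z i ^+ 2 <= N * c ^+ 2 ->
  (\sum_(i <- s) mu i * z i) ^+ 2 <= A ^+ 2 * N `^ (2 * (r - 1) / r) * c ^+ 2.
Proof.
move=> /andP[r1 r2] A0 N0 c0 mu0 z0 hmu hz.
have rhs0 : 0 <= A ^+ 2 * N `^ (2 * (r - 1) / r) * c ^+ 2.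
  by rewrite !mulr_ge0 ?powR_ge0 ?sqr_ge0.
(* The normalisation divides by [A], [N] and [c]; if one of them is zero, all summands vanish. *)
have null : (forall i, i \in s -> mu i * z i = 0) ->
    (\sum_(i <- s) mu i * z i) ^+ 2 <= A ^+ 2 * N `^ (2 * (r - 1) / r) * c ^+ 2.
  by move=> h; rewrite big_seq big1 ?expr0n.
have rp : 0 < r by lra.
have [A_0|An0] := eqVneq A 0.
  apply: null => i si; rewrite A_0 powR0 ?gt_eqF // in hmu.
  suff /powR_eq0_eq0 -> : mu i `^ r = 0 by rewrite mul0r.
  apply/eqP; rewrite eq_le powR_ge0 andbT; apply: le_trans hmu.
  rewrite (big_rem i) //= lerDl sumr_ge0 // => j _; exact: powR_ge0.
have z_null : N * c ^+ 2 = 0 -> forall i, i \in s -> mu i * z i = 0.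
  move=> e i si; rewrite e in hz.
  suff /eqP : z i ^+ 2 = 0 by rewrite sqrf_eq0 => /eqP ->; rewrite mulr0.
  apply/eqP; rewrite eq_le sqr_ge0 andbT; apply: le_trans hz.
  rewrite (big_rem i) //= lerDl sumr_ge0 // => j _; exact: sqr_ge0.
have [N_0|Nn0] := eqVneq N 0; first by apply/null/z_null; rewrite N_0 mul0r.
have [c_0|cn0] := eqVneq c 0.
  by apply/null/z_null; rewrite c_0 expr0n mulr0.
have Ap : 0 < A by rewrite lt_neqAle eq_sym An0.
have Np : 0 < N by rewrite lt_neqAle eq_sym Nn0.
have cp : 0 < c by rewrite lt_neqAle eq_sym cn0.
pose q := r / (r - 1).
have r1p : 0 < r - 1 by lra.
have qp : 0 < q by rewrite divr_gt0.
have rq : r^-1 + q^-1 = 1 by rewrite /q; field; rewrite !gt_eqF.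
have q2 : 2 <= q by rewrite /q ler_pdivlMr //; lra.
(* [c * B] bounds the [q]-norm of [z], as [z i ^ q] is at most [c ^ (q - 2)] times [z i ^ 2]. *)
set B := N `^ q^-1.
have Bp : 0 < B by exact: powR_gt0.
have young i : mu i / A * (z i / (c * B)) <=
    mu i `^ r / A `^ r / r + z i ^+ 2 / (N * c ^+ 2) / q.
  have zi0 : 0 <= z i by have /andP[] := z0 i.
  apply: le_trans (conjugate_powR _ _ rp qp rq) _.
  - by rewrite divr_ge0.
  - by rewrite divr_ge0 // mulr_ge0 // ltW.
  rewrite powRM ?invr_ge0 // lerD //.
    by rewrite -[A^-1]powR_inv1 // powRAC powR_inv1 ?powR_ge0.
  rewrite ler_wpM2r ?invr_ge0 ?(ltW qp) //.
  have -> : z i / (c * B) = (z i / c) * B^-1.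
    by rewrite invfM mulrA.
  rewrite powRM ?invr_ge0 ?divr_ge0 ?(ltW Bp) //.
  have -> : B^-1 `^ q = N^-1.
    have BN : B `^ q = N by rewrite /B -powRrM mulVf ?gt_eqF // powRr1.
    by rewrite -[B^-1]powR_inv1 ?(ltW Bp) // powRAC BN powR_inv1.
  have -> : z i ^+ 2 / (N * c ^+ 2) = (z i / c) ^+ 2 * N^-1.
    by field; rewrite cn0 Nn0.
  rewrite ler_wpM2r ?invr_ge0 //.
  have [->|zn0] := eqVneq (z i) 0; first by rewrite mul0r powR0 ?gt_eqF ?expr0n.
  have zp : 0 < z i / c by rewrite divr_gt0 // lt_neqAle eq_sym zn0.
  (* This is where [r <= 2] enters: it gives [2 <= q], and powers of [z i / c <= 1] decrease with
     the exponent. *)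
  rewrite -powR_mulrn ?(ltW zp) // ger_powR // zp ler_pdivrMr // mul1r.
  by have /andP[] := z0 i.
have total : (\sum_(i <- s) mu i * z i) / (A * (c * B)) <= 1.
  rewrite mulr_suml -rq.
  apply: (@le_trans _ _ (\sum_(i <- s)
      (mu i `^ r / A `^ r / r + z i ^+ 2 / (N * c ^+ 2) / q))).
    apply: ler_sum => i _; apply: le_trans (young i).
    by rewrite invfM mulrACA.
  rewrite big_split /= -!mulr_suml lerD //.
    rewrite ler_piMl ?invr_ge0 ?(ltW rp) // ler_pdivrMr ?powR_gt0 //.
    by rewrite mul1r.
  rewrite ler_piMl ?invr_ge0 ?(ltW qp) // ler_pdivrMr ?mulr_gt0 ?exprn_gt0 //.
  by rewrite mul1r.
rewrite ler_pdivrMr ?mulr_gt0 // mul1r in total.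
have s0 : 0 <= \sum_(i <- s) mu i * z i.
  by apply: sumr_ge0 => i _; rewrite mulr_ge0 //; have /andP[] := z0 i.
have -> : N `^ (2 * (r - 1) / r) = B ^+ 2.
  rewrite -powR_mulrn ?(ltW Bp) // /B -powRrM; congr (_ `^ _).
  by rewrite /q; field; rewrite !gt_eqF.
have -> : A ^+ 2 * B ^+ 2 * c ^+ 2 = (A * (c * B)) ^+ 2 by ring.
by rewrite ler_pXn2r ?nnegrE // !mulr_ge0 // ltW.
Qed.

Lemma big_fset_split (V : zmodType) (I : choiceType) (K0 K : {fset I})
  (f : I -> V) : (K0 `<=` K)%fset ->
  \sum_(i <- K) f i = \sum_(i <- K0) f i + \sum_(i <- (K `\` K0)%fset) f i.
Proof.
move=> /fsubsetP sub; rewrite -big_cat /=; apply: perm_big.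
apply: uniq_perm; rewrite ?fset_uniq //.
  rewrite cat_uniq !fset_uniq andbT /=; apply/hasPn => j.
  by rewrite inE => /andP[].
move=> j; rewrite mem_cat !inE; case: (boolP (j \in K0)) => [/sub ->|_] //.
Qed.

Section delta.
Variables (R : realType) (L F : hilbertType R) (cj : L -> L).
Variables (a ad : L -> F -> F) (Omega : F).
Hypotheses (hcj : conjugation cj) (hF : fock_representation cj a ad Omega).
Implicit Types (f g u v : L) (y z : F) (c : R[i]).

Local Notation al := (annihilation cj a).
Local Notation fockn := (particle_space ad Omega).
Local Notation bad := (bounded_ad hF).

(** A cruder bound, meant for convergence: on a fixed particle space it is proportional to the
    Hilbert-Schmidt sum, so tails are small. *)
Lemma pair_create_particle_le n (J : choiceType) (u v : J -> L) (K : {fset J}) y :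
  complete_orthonormal v -> fockn n y ->
  nm (pair_create ad u v K y) ^+ 2 <=
    (n%:R + 2) * (\sum_(k <- K) nm (u k) ^+ 2) * nm y ^+ 2.
Proof.
move=> cv hy; have [ov _] := cv.
apply: le_trans (pair_create_le hcj hF _ _ (fset_uniq K) ov) _.
set U := \sum_(k <- K) _; have U0 : 0 <= U by apply: sumr_ge0 => k _; exact: sqr_ge0.
have h1 := pair_annihilate_le hcj hF u v K y.
have h2 := sum_CauchySchwarz K (fun k => nm (u k)) (fun k => nm (al (v k) y)).
have h3 := sum_nm_al_le hcj hF cv K hy.
rewrite -/U in h2.
have h4 : nm (pair_annihilate cj a u v K y) ^+ 2 <= U * (n%:R * nm y ^+ 2).
  apply: le_trans (ler_wpM2l U0 h3); apply: le_trans h2.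
  rewrite ler_pXn2r ?nnegrE ?nm_ge0 //.
  by apply: sumr_ge0 => k _; rewrite mulr_ge0 ?nm_ge0.
lra.
Qed.

Lemma pair_create_ad n (J : Type) (u v : J -> L) (s : seq J) y :
  fockn n y -> fockn n.+2 (\sum_(k <- s) ad (u k) (ad (v k) y)).
Proof.
by move=> hy; apply: cspan_bigsum => k; do 2!apply: (particle_space_ad hF).
Qed.

Variables (C : L -> L) (J : choiceType) (x : J -> L) (I : choiceType) (e : I -> L).
Hypotheses (bC : bounded_operator C) (cx : complete_orthonormal x)
  (ce : complete_orthonormal e).
Hypothesis orthC : forall i j, i != j -> ip (C (x i)) (C (x j)) = 0.
Hypothesis tailC : forall eps, 0 < eps -> exists K0 : {fset J},
  forall K : {fset J}, \sum_(j <- (K `\` K0)%fset) nm (C (x j)) ^+ 2 <= eps.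

Definition delta_partial (s : seq J) y := pair_create ad (C \o x) (cj \o x) s y.

(** Chooses the admissible Hilbert-Schmidt tail [t] before the vector to be estimated is known;
    [Y ^+ 2 + 1] keeps the denominator positive. *)
Lemma sqr_small n (eps Y : R) : 0 < eps -> exists2 t, 0 < t &
  forall w : R, 0 <= w -> w ^+ 2 <= (n%:R + 2) * t * Y ^+ 2 -> w < eps.
Proof.
move=> e0; exists ((eps / 2) ^+ 2 / ((n%:R + 2) * (Y ^+ 2 + 1))).
  by rewrite divr_gt0 ?exprn_gt0 ?divr_gt0 // mulr_gt0 ?ltr_wpDl ?sqr_ge0.
move=> w w0 h; apply: (@le_lt_trans _ _ (eps / 2)); last by lra.
rewrite -(ler_pXn2r (ltn0Sn 1)) ?nnegrE ?divr_ge0 ?(ltW e0) //.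
have n2 : 0 < n%:R + 2 :> R by rewrite ltr_wpDl.
have Y1 : 0 < Y ^+ 2 + 1 by rewrite ltr_wpDl ?sqr_ge0.
have E : (n%:R + 2) * ((eps / 2) ^+ 2 / ((n%:R + 2) * (Y ^+ 2 + 1))) * Y ^+ 2 =
    (eps / 2) ^+ 2 * (Y ^+ 2 / (Y ^+ 2 + 1)).
  by field; rewrite !gt_eqF.
rewrite E in h; apply: le_trans h _; rewrite ler_piMr ?sqr_ge0 //.
by rewrite ler_pdivrMr // mul1r lerDl.
Qed.

Lemma delta_partial_cvg n y : fockn n y ->
  exists G, netcvg (fun K : {fset J} => delta_partial K y) G.
Proof.
move=> hy; apply: net_complete => eps e0.
have [t t0 ht] := sqr_small n (nm y) e0.
have [K0 hK0] := tailC t0; exists K0 => K sub.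
rewrite /delta_partial /pair_create (big_fset_split _ sub) addrC addrA addNr add0r.
apply: ht; first exact: nm_ge0.
apply: le_trans (pair_create_particle_le _ _ (complete_orthonormal_cj hcj cx) hy) _.
by rewrite ler_wpM2r ?sqr_ge0 // ler_wpM2l ?addr_ge0 //; exact: hK0.
Qed.

(** The Hilbert-Schmidt sum hardly sees the basis: orthogonality of the [C (x j)] splits each
    square, and Bessel in [e] bounds the weight of every [x j] by 1. *)
Lemma nm_C_proj_sum (M : {fset J}) (K : {fset I}) :
  \sum_(i <- K) nm (C (proj x M (e i))) ^+ 2 <= \sum_(j <- M) nm (C (x j)) ^+ 2.
Proof.
have [oe _] := ce; have [ox _] := cx.
have E i : nm (C (proj x M (e i))) ^+ 2 =
    \sum_(j <- M) normc (ip (x j) (e i)) ^+ 2 * nm (C (x j)) ^+ 2.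
  rewrite /proj (bop_sum bC).
  under eq_bigr do rewrite (bopZ bC).
  rewrite orthogonal_nm_sqr_sum ?fset_uniq // => [|j k jk].
    by apply: eq_bigr => j _; rewrite nmZ exprMn.
  by rewrite ipZl ipZr orthC // !mulr0.
under eq_bigr do rewrite E.
rewrite exchange_big /=; apply: ler_sum => j _; rewrite -mulr_suml.
rewrite ler_piMl ?sqr_ge0 //.
under eq_bigr do rewrite ip_conj normc_conj.
apply: le_trans (Bessel _ (fset_uniq _) oe) _.
by rewrite nm_orthonormal // expr1n.
Qed.

(* Truncating [C] outside the span of [x k], [k] in [K0], costs only the tail
   of the Hilbert-Schmidt norm, uniformly in the partial sums over [e]. *)
Lemma truncation_le n y (K0 : {fset J}) (t : R) (K : {fset I}) :
  0 <= t -> fockn n y ->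
  (forall M : {fset J}, \sum_(j <- (M `\` K0)%fset) nm (C (x j)) ^+ 2 <= t) ->
  nm (pair_create ad (fun i => C (e i - proj x K0 (e i))) (cj \o e) K y) ^+ 2 <=
    (n%:R + 2) * t * nm y ^+ 2.
Proof.
move=> t0 hy ht; have n2 : 0 <= n%:R + 2 :> R by rewrite addr_ge0.
set B := (X in _ <= X); have B0 : 0 <= B.
  by apply: mulr_ge0; [exact: mulr_ge0|exact: sqr_ge0].
(* The remainder [e i - proj x K0 (e i)] is approached by projections onto finite sets outside [K0],
   for which the bound holds uniformly in [M]. *)
pose S (M : {fset J}) := pair_create ad
  (fun i => C (proj x (M `\` K0)%fset (e i))) (cj \o e) K y.
have SB M : nm (S M) <= Num.sqrt B.
  rewrite -(ler_pXn2r (ltn0Sn 1)) ?nnegrE ?nm_ge0 ?sqrtr_ge0 // sqr_sqrtr //.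
  apply: le_trans (pair_create_particle_le _ _ (complete_orthonormal_cj hcj ce) hy) _.
  rewrite ler_wpM2r ?sqr_ge0 // ler_wpM2l //.
  exact: le_trans (nm_C_proj_sum _ _) (ht M).
have Scvg : netcvg S (pair_create ad
    (fun i => C (e i - proj x K0 (e i))) (cj \o e) K y).
  apply: netcvg_bigsum => i; have [M M0 hM] := bop_bound bC.
  apply: (@netcvg_map _ _ _ _ (fun M : {fset J} => proj x (M `\` K0)%fset (e i))
    (e i - proj x K0 (e i)) (fun f => ad (C f) (ad (cj (e i)) y))
    (M * nm (ad (cj (e i)) y))) => [f g|f|].
  - by rewrite (bopD bC) (bopN bC) (adBf hF).
  - apply: le_trans (nm_ad hcj hF _ _) _; rewrite mulrAC ler_wpM2r ?nm_ge0 //.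
  - move=> eps /(netcvg_proj cx (e i))[K1 hK1]; exists (K1 `|` K0)%fset => K'.
    rewrite fsubUset => /andP[/hK1 h sub]; rewrite -addrA -opprD.
    by rewrite /proj -(big_fset_split _ sub).
have := netcvg_nm_le Scvg SB.
by rewrite -(ler_pXn2r (ltn0Sn 1)) ?nnegrE ?nm_ge0 ?sqrtr_ge0 // sqr_sqrtr.
Qed.

(** The limit in the eigenbasis is also the limit in [e]: the finite sum over [K] in the eigenbasis
    is near [G], and the sum over [e] differs little from the expansion of that finite sum in
    [e]. *)
Lemma pair_create_basis_cvg n y G : fockn n y ->
  netcvg (fun K : {fset J} => delta_partial K y) G ->
  netcvg (fun K : {fset I} => \sum_(i <- K) ad (C (e i)) (ad (cj (e i)) y)) G.
Proof.
move=> hy hG eps e0; have e3 : 0 < eps / 3 by rewrite divr_gt0.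
have [t t0 ht] := sqr_small n (nm y) e3.
have [K0 hK0] := tailC t0; have [K1 hK1] := hG _ e3.
pose K := (K0 `|` K1)%fset.
have hK M : \sum_(j <- (M `\` K)%fset) nm (C (x j)) ^+ 2 <= t.
  apply: le_trans (hK0 M); apply: sum_le_subset => [||j|j]; rewrite ?fset_uniq ?sqr_ge0 //.
  by rewrite !inE negb_or -andbA => /and3P[-> _ ->].
(* [T M] mediates between the bases: for fixed [K] it tends to [delta_partial K y] as [M] grows. *)
pose T (M : {fset I}) := \sum_(k <- K) ad (C (x k)) (ad (cj (proj e M (x k))) y).
have hT : netcvg T (delta_partial K y).
  apply: netcvg_bigsum => k.
  apply: (@netcvg_map _ _ _ _ (fun M : {fset I} => proj e M (x k)) (x k)
    (fun f => ad (C (x k)) (ad (cj f) y)) (nm (C (x k)) * nm y)) => [f g|f|].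
  - by rewrite (cjB hcj) (adBf hF) (bopD (bad _)) (bopN (bad _)).
  - apply: le_trans (nm_ad hcj hF _ _) _; rewrite -mulrA ler_wpM2l ?nm_ge0 //.
    by rewrite mulrC; have := nm_ad hcj hF (cj f) y; rewrite (nm_cj hcj).
  - exact: netcvg_proj.
have [M0 hM0] := hT _ e3; exists M0 => M /hM0 h2.
have h1 := hK1 K (fsubsetUr _ _).
(* [cj] turns the coefficient [ip (e i) (x k)] into [ip (x k) (e i)], so exchanging the finite sums
   shows [T M] as the sum over [e] with [C] truncated to the [x k], [k] in [K]. *)
have E : \sum_(i <- M) ad (C (e i)) (ad (cj (e i)) y) - T M =
    pair_create ad (fun i => C (e i - proj x K (e i))) (cj \o e) M y.
  rewrite /pair_create; under [RHS]eq_bigr do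
    rewrite (bopD bC) (bopN bC) (adBf hF).
  rewrite sumrB; congr (_ - _); rewrite /T /proj.
  under eq_bigr => k _.
    rewrite (cj_sum hcj) (ad_sumf hF) (bop_sum (bad _)).
    under eq_bigr => i _ do
      rewrite (cjZ hcj) (adZf hF) (bopZ (bad _)) -ip_conj.
    over.
  rewrite exchange_big /=; apply: eq_bigr => i _.
  rewrite (bop_sum bC) (ad_sumf hF); apply: eq_bigr => k _.
  by rewrite (bopZ bC) (adZf hF).
have h3 : nm (T M - \sum_(i <- M) ad (C (e i)) (ad (cj (e i)) y)) < eps / 3.
  rewrite nmBC E; apply: ht; first exact: nm_ge0.
  by apply: truncation_le => //; exact: ltW.
have := nmB_trans (delta_partial K y) G
  (\sum_(i <- M) ad (C (e i)) (ad (cj (e i)) y)).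
have := nmB_trans (T M) (delta_partial K y)
  (\sum_(i <- M) ad (C (e i)) (ad (cj (e i)) y)).
lra.
Qed.

End delta.

(** * Graded estimates *)

Section graded.
Variables (R : realType) (L F : hilbertType R) (cj : L -> L).
Variables (a ad : L -> F -> F) (Omega : F).
Hypotheses (hcj : conjugation cj) (hF : fock_representation cj a ad Omega).
Variables (I : choiceType) (e : I -> L).
Hypothesis ce : complete_orthonormal e.
Implicit Types (y z : F).

Local Notation al := (annihilation cj a).
Local Notation fockn := (particle_space ad Omega).
Local Notation bad := (bounded_ad hF).

(** Asking the equality for all large [M] lets two vectors be added under a common truncation. *)
Lemma finite_particle_graded y : finite_particle ad Omega y ->
  exists2 f : nat -> F, (forall n, fockn n (f n)) &
    exists N, forall M, (N <= M)%N -> y = \sum_(n < M) f n.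
Proof.
apply: (lspan_ind (P := [set y | exists2 f : nat -> F, (forall n, fockn n (f n)) &
    exists N, forall M, (N <= M)%N -> y = \sum_(n < M) f n])) => /=
  [|c u v [f hf [N hN]] [g hg [M hM]]|v [m _ hv]].
- exists (fun=> 0) => [n|]; first exact/sub_cspan/lspan0.
  by exists 0%N => M _; rewrite big1.
- exists (fun n => c *: f n + g n) => [n|].
    by apply: cspan_lin; [exact: hf|exact: hg].
  exists (maxn N M) => K; rewrite geq_max => /andP[/hN -> /hM ->].
  by rewrite scaler_sumr -big_split.
exists (fun n => if n == m then v else 0) => [n|].
  by have [->//|_] := eqVneq n m; exact/sub_cspan/lspan0.
exists m.+1 => M mM; rewrite (bigD1 (Ordinal mM)) //= eqxx big1 ?addr0 // => i.
by rewrite -val_eqE /= => /negPf ->.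
Qed.

Lemma number_operator_particle n y :
  fockn n y -> number_operator cj a ad e y = n%:R%:C *: y.
Proof. by move=> hy; apply: netcvg_sum; exact: (netcvg_number hcj hF ce hy). Qed.

Lemma number_operator_graded N (f : nat -> F) : (forall n, fockn n (f n)) ->
  number_operator cj a ad e (\sum_(n < N) f n) = \sum_(n < N) n%:R%:C *: f n.
Proof.
move=> hf; apply: netcvg_sum; apply: (@netcvg_ext _ _ _
  (fun K => \sum_(n < N) number_partial cj a ad e K (f n))) => [|K].
  by apply: netcvg_bigsum => n; exact: (netcvg_number hcj hF ce (hf n)).
by rewrite -(bop_sum (bounded_number_partial hF e K)).
Qed.

Lemma ip_graded N (f : nat -> F) (g : nat -> R) : (forall n, fockn n (f n)) ->
  ip (\sum_(n < N) f n) (\sum_(n < N) (g n)%:C *: f n) =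
  (\sum_(n < N) g n * nm (f n) ^+ 2)%:C.
Proof.
move=> hf; rewrite ip_sumr rmorph_sum /=; apply: eq_bigr => n _.
rewrite ipZr ip_suml (bigD1 n) //= big1 => [|m mn].
  by rewrite addr0 ip_self -rmorphM.
exact: (particle_space_orthogonal hcj hF ce (hf m) (hf n)).
Qed.

(** Pairing the eigenvalue equation with each component kills those with [n] different from [lam].
    It controls the unspecified eigenvectors that occur in [number_power]. *)
Lemma number_eigenvector y (lam : R) : finite_particle ad Omega y ->
  number_operator cj a ad e y = lam%:C *: y ->
  y = 0 \/ exists2 n : nat, lam = n%:R & fockn n y.
Proof.
move=> /finite_particle_graded[f hf [N /(_ _ (leqnn N)) yE]] ey.
have h n : (n < N)%N -> lam != n%:R -> f n = 0.
  move=> nN ln; pose k := Ordinal nN.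
  have : ip (f n) (number_operator cj a ad e y - lam%:C *: y) = 0.
    by rewrite ey subrr ip0r.
  rewrite yE number_operator_graded // scaler_sumr -sumrB ip_sumr.
  rewrite (bigD1 k) //= big1 => [|m mk]; last first.
    rewrite ipBr !ipZr (particle_space_orthogonal hcj hF ce (hf n) (hf m)) //.
      by rewrite !mulr0 subrr.
    by rewrite eq_sym; move: mk; rewrite -val_eqE.
  rewrite addr0 -scalerBl ipZr ip_self => /eqP; rewrite mulf_eq0 => /orP[|].
    by rewrite subr_eq0 => /eqP/complexI /esym/eqP; rewrite (negPf ln).
  move=> /eqP/(congr1 (@complex.Re R)) /= /eqP.
  by rewrite sqrf_eq0 nm_eq0 => /eqP.
have [[n nN ln]|no] := pselect (exists2 n : nat, (n < N)%N & lam = n%:R).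
  right; exists n => //; rewrite yE (bigD1 (Ordinal nN)) //= big1 ?addr0 // => m mn.
  by apply: h => //; rewrite ln eqr_nat eq_sym; move: mn; rewrite -val_eqE.
left; rewrite yE big1 // => n _; apply: h => //.
by apply/eqP => ln; apply: no; exists n.
Qed.

(** [get] selects some decomposition into eigenvectors; each of them lies in a particle space, and
    collecting those of equal particle number makes the decomposition graded. *)
Lemma number_power_graded y (s : R) : finite_particle ad Omega y ->
  exists N (f : nat -> F), [/\ forall n, fockn n (f n), y = \sum_(n < N) f n &
    number_power cj a ad Omega e s y = \sum_(n < N) (n%:R `^ s)%:C *: f n].
Proof.
move=> hy; rewrite /number_power /operator_power; set S := (X in get X).
have [f hf [N /(_ _ (leqnn N)) yE]] := finite_particle_graded hy.
have : exists Psi, S Psi.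
  exists (\sum_(n < N) (n%:R `^ s)%:C *: f n); rewrite /S /=.
  exists N, (fun n : 'I_N => n%:R), (fun n : 'I_N => f n); split=> // k.
  split=> //; last exact: number_operator_particle.
  by apply: sub_lspan; exists (k : nat).
move=> /getPex[m [lam [phi [hphi -> ->]]]].
have /choice[d hd] : forall k, exists n : nat, fockn n (phi k) /\
    (lam k `^ s)%:C *: phi k = (n%:R `^ s)%:C *: phi k.
  move=> k; have [_ Dk /(number_eigenvector Dk)[->|[n -> hn]]] := hphi k.
    (* A zero summand does not determine its eigenvalue; the label 0 is a harmless default. *)
    by exists 0%N; rewrite !scaler0; split=> //; exact/sub_cspan/lspan0.
  by exists n.
pose M := (\max_k d k).+1.
have group (c : nat -> R) : \sum_(n < M) (c n)%:C *:
      (\sum_k if d k == n then phi k else 0) = \sum_k (c (d k))%:C *: phi k.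
  under eq_bigr do rewrite scaler_sumr.
  rewrite exchange_big /=; apply: eq_bigr => k _.
  have dM : (d k < M)%N by rewrite ltnS; exact: leq_bigmax.
  rewrite (bigD1 (Ordinal dM)) //= eqxx big1 ?addr0 // => n.
  by rewrite -val_eqE /= eq_sym => /negPf ->; rewrite scaler0.
exists M, (fun n => \sum_k if d k == n then phi k else 0); split=> [n||].
- apply: cspan_bigsum => k; have [<-|_] := eqVneq; first by have [] := hd k.
  exact/sub_cspan/lspan0.
- have := group (fun=> 1); under eq_bigr do rewrite scale1r.
  by move=> ->; apply: eq_bigr => k _; rewrite scale1r.
rewrite (group (fun n => n%:R `^ s)); apply: eq_bigr => k _.
by have [] := hd k.
Qed.

Variables (C : L -> L) (J : choiceType) (x : J -> L).
Hypotheses (bC : bounded_operator C) (cx : complete_orthonormal x).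
Hypothesis orthC : forall i j, i != j -> ip (C (x i)) (C (x j)) = 0.
Hypothesis tailC : forall eps, 0 < eps -> exists K0 : {fset J},
  forall K : {fset J}, \sum_(j <- (K `\` K0)%fset) nm (C (x j)) ^+ 2 <= eps.

Lemma bounded_delta_partial (s : seq J) :
  bounded_operator (delta_partial cj ad C x s).
Proof.
apply: bounded_operator_sum => j.
exact: (bounded_operator_comp (bad (C (x j))) (bad (cj (x j)))).
Qed.

Lemma DeltaPlus_cvg y : finite_particle ad Omega y ->
  netcvg (fun K : {fset J} => delta_partial cj ad C x K y) (DeltaPlus cj ad e C y).
Proof.
move=> /finite_particle_graded[f hf [N /(_ _ (leqnn N)) ->]].
have /choice[G hG] : forall n : 'I_N, exists G, netcvg
    (fun K : {fset J} => delta_partial cj ad C x K (f n)) G.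
  by move=> n; exact: (delta_partial_cvg hcj hF cx tailC (hf n)).
have -> : DeltaPlus cj ad e C (\sum_(n < N) f n) = \sum_n G n.
  apply: netcvg_sum; apply: (@netcvg_ext _ _ _ (fun K : {fset I} => \sum_(n < N)
    \sum_(i <- K) ad (C (e i)) (ad (cj (e i)) (f n)))) => [|K].
    apply: netcvg_bigsum => n.
    exact: (pair_create_basis_cvg hcj hF bC cx ce orthC tailC (hf n) (hG n)).
  rewrite exchange_big /=; apply: eq_bigr => i _.
  by rewrite (bop_sum (bad _)) (bop_sum (bad _)).
apply: (@netcvg_ext _ _ _
  (fun K : {fset J} => \sum_(n < N) delta_partial cj ad C x K (f n))) => [|K].
  exact: netcvg_bigsum.
by rewrite (bop_sum (bounded_delta_partial K)).
Qed.

Lemma delta_partial_trace_le (B : R) (K : {fset J}) y :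
  \sum_(j <- K) nm (C (x j)) <= B -> nm (delta_partial cj ad C x K y) <= B * nm y.
Proof.
move=> hB; apply: le_trans (nm_sum _ _) _.
apply: (@le_trans _ _ (\sum_(j <- K) nm (C (x j)) * nm y)).
  apply: ler_sum => j _; apply: le_trans (nm_ad hcj hF _ _) _.
  rewrite ler_wpM2l ?nm_ge0 //; have := nm_ad hcj hF (cj (x j)) y.
  by rewrite (nm_cj hcj) (nm_orthonormal _ (proj1 cx)) mul1r.
by rewrite -mulr_suml ler_wpM2r ?nm_ge0.
Qed.

Lemma delta_partial_particle_le (r A B : R) (K : {fset J}) n y : 1 < r <= 2 ->
  0 <= A -> \sum_(j <- K) nm (C (x j)) `^ r <= A `^ r ->
  \sum_(j <- K) nm (C (x j)) ^+ 2 <= B ^+ 2 -> fockn n y ->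
  nm (delta_partial cj ad C x K y) ^+ 2 <=
    (A ^+ 2 * n%:R `^ (2 * (r - 1) / r) + 2 * B ^+ 2) * nm y ^+ 2.
Proof.
move=> hr A0 hA hB hy.
have cv := complete_orthonormal_cj hcj cx; have [ov _] := cv.
apply: le_trans (pair_create_le hcj hF _ _ (fset_uniq K) ov) _.
rewrite [leRHS]mulrDl lerD //; last by rewrite ler_wpM2r ?sqr_ge0 // ler_wpM2l.
have z1 k : 0 <= nm (al ((cj \o x) k) y) <= nm y.
  rewrite nm_ge0 /=; have := nm_al hcj hF (cj (x k)) y.
  by rewrite (nm_cj hcj) (nm_orthonormal _ (proj1 cx)) mul1r.
have := weighted_Hoelder hr A0 (ler0n R n) (nm_ge0 y)
  (fun k => nm_ge0 (C (x k))) z1 hA (sum_nm_al_le hcj hF cv K hy).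
apply: le_trans; rewrite ler_pXn2r ?nnegrE ?nm_ge0 //.
  exact: (pair_annihilate_le hcj hF).
by apply: sumr_ge0 => k _; rewrite mulr_ge0 ?nm_ge0.
Qed.

(** Pair creation shifts the particle number by two, so the images of the components are orthogonal
    and the bounds add without cross terms. *)
Lemma delta_partial_graded_le (r A B : R) (K : {fset J}) N (f : nat -> F) :
  1 < r <= 2 -> 0 <= A -> \sum_(j <- K) nm (C (x j)) `^ r <= A `^ r ->
  \sum_(j <- K) nm (C (x j)) ^+ 2 <= B ^+ 2 -> (forall n, fockn n (f n)) ->
  nm (delta_partial cj ad C x K (\sum_(n < N) f n)) ^+ 2 <=
  \sum_(n < N) (A ^+ 2 * n%:R `^ (2 * (r - 1) / r) + 2 * B ^+ 2) * nm (f n) ^+ 2.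
Proof.
move=> hr A0 hA hB hf; rewrite (bop_sum (bounded_delta_partial K)).
rewrite orthogonal_nm_sqr_sum ?index_enum_uniq // => [|i j ij].
  by apply: ler_sum => n _; exact: delta_partial_particle_le.
apply: (particle_space_orthogonal hcj hF ce (n := i.+2) (m := j.+2)).
- exact: (pair_create_ad hF).
- exact: (pair_create_ad hF).
by move: ij; rewrite !eqSS -val_eqE.
Qed.

End graded.

(** * Passage to the limit and the two cases *)

Theorem theorem3p7 (R : realType) (L F : hilbertType R) (cj : L -> L)
    (a ad : L -> F -> F) (Omega : F) (I : choiceType) (e : I -> L)
    (r : R) (C : L -> L) :
  separable L ->
  conjugation cj ->
  fock_representation cj a ad Omega ->
  complete_orthonormal e ->
  1 <= r <= 2 ->
  schatten_antisym cj r C ->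
  let s := 2 * (r - 1) / r in
  forall Phi : F, finite_particle ad Omega Phi ->
    (r = 1 ->
       `|DeltaPlus cj ad e C Phi| ^+ 2 <=
         (schatten_norm 1 C ^+ 2)%:C * ip Phi Phi) /\
    (1 < r ->
       `|DeltaPlus cj ad e C Phi| ^+ 2 <=
         (schatten_norm r C ^+ 2)%:C *
           ip Phi (number_power cj a ad Omega e s Phi) +
         3 * (schatten_norm 2 C ^+ 2)%:C * ip Phi Phi).
Proof.
move=> _ hcj hF ce hr [hC _] s Phi hPhi.
have [bC _] := hC.
have [J [x [cx orthC hA hB tailC]]] := schatten_svd bC hr hC.
have cvg := DeltaPlus_cvg hcj hF ce bC cx orthC tailC hPhi.
have norm_ge0 p : 0 <= schatten_norm p C.
  have [_ [J' [mu [hmu _]]]] := hC.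
  by rewrite (schatten_normE bC p hmu) powR_ge0.
(* Norm bounds survive the limit of the net; the square root converts the quadratic bound into
   one. *)
have sqrtB (B : R) : 0 <= B -> (forall K : {fset J},
    nm (delta_partial cj ad C x K Phi) ^+ 2 <= B) ->
    nm (DeltaPlus cj ad e C Phi) ^+ 2 <= B.
  move=> B0 h; have sqB y : (nm y ^+ 2 <= B) = (nm y <= Num.sqrt B).
    by rewrite -{1}(sqr_sqrtr B0) ler_pXn2r // nnegrE ?nm_ge0 ?sqrtr_ge0.
  by rewrite sqB; apply: netcvg_nm_le cvg _ => K; rewrite -sqB.
split=> [r1|r1].
  rewrite nmE ip_self -rmorphXn -rmorphM /= lecR.
  apply: sqrtB => [|K]; first by rewrite mulr_ge0 ?sqr_ge0.
  rewrite -exprMn ler_pXn2r ?nnegrE ?nm_ge0 ?mulr_ge0 ?nm_ge0 //.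
  apply: (delta_partial_trace_le hcj hF cx).
  have := hA K; rewrite r1 powRr1 //; apply: le_trans.
  by apply: ler_sum => j _; rewrite powRr1 ?nm_ge0.
(* The components [f n] that evaluate [number_power] are also used to grade [Phi], so both sides
   become sums over the same [nm (f n) ^+ 2]. *)
have [N [f [hf PhiE ->]]] := number_power_graded hcj hF ce s hPhi.
have -> : ip Phi (\sum_(n < N) (n%:R `^ s)%:C *: f n) =
    (\sum_(n < N) n%:R `^ s * nm (f n) ^+ 2)%:C.
  by rewrite {1}PhiE; exact: (ip_graded hcj hF ce N (fun n => n%:R `^ s)).
rewrite ip_self nmE.
have -> : (3 : R[i]) = 3%:C by rewrite rmorph_nat.
rewrite -rmorphXn -!rmorphM -rmorphD /= lecR.
have PhiN : nm Phi ^+ 2 = \sum_(n < N) nm (f n) ^+ 2.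
  rewrite PhiE orthogonal_nm_sqr_sum ?index_enum_uniq // => i j ij.
  exact: (particle_space_orthogonal hcj hF ce (hf i) (hf j)).
apply: sqrtB => [|K].
  apply: addr_ge0; last by apply: mulr_ge0; rewrite ?sqr_ge0 // mulr_ge0 ?sqr_ge0.
  apply: mulr_ge0; first exact: sqr_ge0.
  apply: sumr_ge0 => n _.
  by rewrite mulr_ge0 ?powR_ge0 ?sqr_ge0.
have /andP[_ r2] := hr.
rewrite {1}PhiE; apply: le_trans (delta_partial_graded_le hcj hF ce cx N
  _ (norm_ge0 r) (hA K) (hB K) hf) _; first by rewrite r1.
rewrite PhiN !mulr_sumr -big_split /=; apply: ler_sum => n _.
rewrite mulrDl -mulrA lerD2l ler_wpM2r ?sqr_ge0 // ler_wpM2r ?sqr_ge0 //.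
(* Normal ordering yields the constant 2, which is below the 3 of the claim. *)
by rewrite ler_nat.
Qed.
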